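(* The notions of being toroidally related and of being isoclinic coincide, in the following sense. (i) If $1\to A_1\to G_1\to G\to1$ and $1\to A_2\to G_2\to G\to 1$ are toroidally related central extensions of a finite group $G$ by finite abelian groups $A_1,A_2$, then $G_1$ and $G_2$ are isoclinic. (ii) Conversely, if $G_1$ and $G_2$ are isoclinic finite groups with centers $Z_1,Z_2$, and $G:=G_1/Z_1\simeq G_2/Z_2$ (identified via the isomorphism which is part of the isoclinism), then the central extensions $1\to Z_1\to G_1\to G\to 1$ and $1\to Z_2\to G_2\to G\to1$ are toroidally related. In particular, if $G_1$ and $G_2$ are isoclinic finite groups, then generically free linear quotients $V_1/G_1$ and $V_2/G_2$ are stably birationally equivalent (where $V_i$ is any finite-dimensional generically free complex representation of $G_i$).
   Context: Isoclinic: two finite groups $G_1,G_2$ with centers $Z_1,Z_2$ are isoclinic if there are isomorphisms $i:G_1/Z_1\to G_2/Z_2$ and $j:[G_1,G_1]\to[G_2,G_2]$ compatible with commutators, i.e. $j([g,h])=[g',h']$ whenever $g,h\in G_1$ and $g',h'\in G_2$ satisfy $i(gZ_1)=g'Z_2$, $i(hZ_1)=h'Z_2$. Toroidally related: two central extensions $e_1: 1\to A_1\to G_1\to G\to1$ and $e_2:1\to A_2\to G_2\to G\to1$ of a finite group $G$ by finite abelian groups are toroidally related if there are an algebraic torus $T\simeq(\mathbb{C}^* )^r$ (a trivial $G$-module) and embeddings $i_k:A_k\hookrightarrow T$, $k=1,2$, such that the images of $e_1\in H^2(G,A_1)$ and $e_2\in H^2(G,A_2)$ in $H^2(G,T)$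 coincide. Two varieties $X,Y$ are stably birationally equivalent if $X\times\mathbb{P}^a$ and $Y\times\mathbb{P}^b$ are birational for some $a,b\ge0$. *)

(* Defs.v *)
From HB Require Import structures.
From mathcomp Require Import all_boot all_order all_algebra all_fingroup.
From mathcomp Require Import all_solvable mxrepresentation.
From mathcomp Require Import boolp classical_sets reals complex.
From mathcomp Require mpoly.

Set Implicit Arguments.
Unset Strict Implicit.
Unset Printing Implicit Defensive.

Import GRing.Theory.

Local Open Scope classical_set_scope.
Local Open Scope ring_scope.

(** * Isoclinism *)

Section Isoclinism.
Local Open Scope group_scope.

(* MathComp's commutator is [~ x, y] = x^-1 * y^-1 * x * y; the notion does
   not depend on this choice. *)
Record isoclinism (gT1 gT2 : finGroupType)
    (G1 : {group gT1}) (G2 : {group gT2}) := Isoclinism {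
  iso_quo : {morphism (G1 / 'Z(G1)) >-> coset_of 'Z(G2)};
  iso_der : {morphism [~: G1, G1] >-> gT2};
  iso_quo_isom : isom (G1 / 'Z(G1)) (G2 / 'Z(G2)) iso_quo;
  iso_der_isom : isom [~: G1, G1] [~: G2, G2] iso_der;
  iso_comm : forall g h g' h',
    g \in G1 -> h \in G1 -> g' \in G2 -> h' \in G2 ->
    iso_quo (coset 'Z(G1) g) = coset 'Z(G2) g' ->
    iso_quo (coset 'Z(G1) h) = coset 'Z(G2) h' ->
    iso_der [~ g, h] = [~ g', h'] }.

Definition isoclinic (gT1 gT2 : finGroupType)
    (G1 : {group gT1}) (G2 : {group gT2}) : Prop :=
  inhabited (isoclinism G1 G2).

End Isoclinism.

(** * Central extensions *)

Section CentralExtension.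
Local Open Scope group_scope.

(* 1 -> A -> E -> Q -> 1.  The kernel A is automatically abelian, being
   isomorphic to a subgroup of 'Z(E). *)
Record central_extension (aT gT qT : finGroupType)
    (A : {group aT}) (E : {group gT}) (Q : {group qT}) := CentralExtension {
  ext_inj : {morphism A >-> gT};
  ext_prj : {morphism E >-> qT};
  ext_injective : 'injm ext_inj;
  ext_exact : ext_inj @* A = 'ker ext_prj;
  ext_surjective : ext_prj @* E = Q;
  ext_central : ext_inj @* A \subset 'Z(E) }.

Section Center.
Variables (gT : finGroupType) (G : {group gT}).

Definition center_prj := restrm (normal_norm (center_normal G)) (coset 'Z(G)).
Canonical center_prj_morphism := [morphism of center_prj].

Lemma center_inj_injective : 'injm (idm 'Z(G)).
Proof. exact: injm_idm. Qed.

Lemma center_exact : idm 'Z(G) @* 'Z(G) = 'ker center_prj.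
Proof.
rewrite morphim_idm // ker_restrm ker_coset.
exact/esym/finset.setIidPr/center_sub.
Qed.

Lemma center_surjective : center_prj @* G = G / 'Z(G).
Proof. by rewrite morphim_restrm finset.setIid. Qed.

Lemma center_central : idm 'Z(G) @* 'Z(G) \subset 'Z(G).
Proof. by rewrite morphim_idm. Qed.

Definition center_extension : central_extension 'Z(G) G (G / 'Z(G)) :=
  CentralExtension center_inj_injective center_exact center_surjective
    center_central.

End Center.

Section Transport.
Variables (aT gT qT qT' : finGroupType).
Variables (A : {group aT}) (E : {group gT}) (Q : {group qT}) (Q' : {group qT'}).
Variables (e : central_extension A E Q) (f : {morphism Q >-> qT'}).
Hypothesis isof : isom Q Q' f.

Lemma transport_sub : E \subset ext_prj e @*^-1 Q.
Proof. by rewrite -sub_morphim_pre // ext_surjective. Qed.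

Definition transport_prj := restrm transport_sub (f \o ext_prj e).
Canonical transport_prj_morphism := [morphism of transport_prj].

Lemma transport_exact : ext_inj e @* A = 'ker transport_prj.
Proof.
rewrite ker_restrm ker_comp (trivgP (isom_inj isof)) -kerE ext_exact.
by apply/esym/finset.setIidPr; apply: finset.subsetIl.
Qed.

Lemma transport_surjective : transport_prj @* E = Q'.
Proof.
by rewrite morphim_restrm finset.setIid morphim_comp ext_surjective (isom_im isof).
Qed.

(* The same extension, with quotient identified with Q' through f. *)
Definition transport_extension : central_extension A E Q' :=
  CentralExtension (ext_injective e) transport_exact transport_surjective
    (ext_central e).

End Transport.
End CentralExtension.

(** * The torus and toroidally related extensions *)

Section Cstar.
Variable R : rcfType.

Record Cstar := MkCstar { Cstar_val : R[i]; _ : Cstar_val != 0 }.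

HB.instance Definition _ := [isSub for Cstar_val].
HB.instance Definition _ := [Choice of Cstar by <:].

Definition Cstar_one : Cstar := MkCstar (oner_neq0 _).

Definition Cstar_mul (x y : Cstar) : Cstar :=
  MkCstar (mulf_neq0 (valP x) (valP y)).

Lemma Cstar_inv_subproof (x : Cstar) : (val x)^-1 != 0.
Proof. by rewrite invr_eq0 (valP x). Qed.

Definition Cstar_inv (x : Cstar) : Cstar := MkCstar (Cstar_inv_subproof x).

Lemma Cstar_mulA : associative Cstar_mul.
Proof. by move=> x y z; apply/val_inj/mulrA. Qed.

Lemma Cstar_mul1 : left_id Cstar_one Cstar_mul.
Proof. by move=> x; apply/val_inj/mul1r. Qed.

Lemma Cstar_mulr1 : right_id Cstar_one Cstar_mul.
Proof. by move=> x; apply/val_inj/mulr1. Qed.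

Lemma Cstar_mulV : left_inverse Cstar_one Cstar_inv Cstar_mul.
Proof. by move=> x; apply/val_inj/mulVf/(valP x). Qed.

Lemma Cstar_mulrV : right_inverse Cstar_one Cstar_inv Cstar_mul.
Proof. by move=> x; apply/val_inj/mulfV/(valP x). Qed.

HB.instance Definition _ := isGroup.Build Cstar
  Cstar_mulA Cstar_mul1 Cstar_mulr1 Cstar_mulV Cstar_mulrV.

End Cstar.

Definition torus (R : rcfType) (r : nat) : groupType := {ffun 'I_r -> Cstar R}.

Section Cohomology.
Local Open Scope group_scope.

(* Cochains on Q are functions on the ambient type; only their values on Q
   matter. *)

Definition coboundary2 (qT : finGroupType) (Q : {group qT}) (M : groupType)
    (d : qT -> qT -> M) : Prop :=
  exists b : qT -> M,
    {in Q &, forall x y, d x y = b x * b y * (b (x * y))^-1}.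

(* The class of the 2-cocycle c in H^2(Q, M) = Z^2(Q, M) / B^2(Q, M), for an
   abelian group M on which Q acts trivially. *)
Definition H2_class (qT : finGroupType) (Q : {group qT}) (M : groupType)
    (c : qT -> qT -> M) : set (qT -> qT -> M) :=
  [set c' | exists2 d, coboundary2 Q d &
              {in Q &, forall x y, c' x y = c x y * d x y}].

Variables (aT gT qT : finGroupType).
Variables (A : {group aT}) (E : {group gT}) (Q : {group qT}).
Implicit Type e : central_extension A E Q.

(* The factor sets of e, over all set-theoretic sections s, are exactly the
   cocycles in the class of e in H^2(Q, A). *)
Definition factor_set e (c : qT -> qT -> aT) : Prop :=
  exists s : qT -> gT,
    {in Q, forall x, s x \in E /\ ext_prj e (s x) = x} /\
    {in Q &, forall x y,
       c x y \in A /\ s x * s y = ext_inj e (c x y) * s (x * y)}.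

(* The image of the class of e under H^2(Q, A) -> H^2(Q, M). *)
Definition H2_image e (M : groupType) (i : aT -> M) : set (qT -> qT -> M) :=
  \bigcup_(c in factor_set e) H2_class Q (fun x y => i (c x y)).

Definition embedding (M : groupType) (i : aT -> M) : Prop :=
  {in A &, {morph i : x y / x * y}} /\ {in A &, injective i}.

End Cohomology.

Definition toroidally_related (R : rcfType)
    (aT1 gT1 aT2 gT2 qT : finGroupType)
    (A1 : {group aT1}) (E1 : {group gT1}) (A2 : {group aT2}) (E2 : {group gT2})
    (Q : {group qT})
    (e1 : central_extension A1 E1 Q) (e2 : central_extension A2 E2 Q) : Prop :=
  exists (r : nat) (i1 : aT1 -> torus R r) (i2 : aT2 -> torus R r),
    [/\ embedding A1 i1, embedding A2 i2 & H2_image e1 i1 = H2_image e2 i2].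

(** * Varieties as spaces with functions *)

(* A classical complex variety is given by its points, its Zariski open
   sets, and its regular functions: [regular X U f] says that the restriction
   of f to the open set U is regular; values of f outside U are irrelevant. *)
Record fspace (C : Type) := FSpace {
  point : Type;
  zopen : set (set point);
  regular : set point -> set (point -> C) }.

Section FSpace.
Variable C : fieldType.
Implicit Types X Y : fspace C.

Section Affine.
Variable n : nat.

Definition peval (p : mpoly.mpoly n C) (v : 'rV[C]_n) : C :=
  mpoly.meval (fun k => v 0 k) p.

Definition affine_open (U : set 'rV[C]_n) : Prop :=
  exists S : set (mpoly.mpoly n C),
    U = [set v | exists2 p, S p & peval p v != 0].

Definition affine_regular (U : set 'rV[C]_n) (f : 'rV[C]_n -> C) : Prop :=
  forall v, U v -> exists (W : set 'rV[C]_n) (p q : mpoly.mpoly n C),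
    [/\ affine_open W, W v, W `<=` U &
        forall w, W w -> peval q w != 0 /\ f w = peval p w / peval q w].

Definition affine_space : fspace C :=
  @FSpace C 'rV[C]_n affine_open affine_regular.

End Affine.

(* The quotient D / r of an open subset D of X by an equivalence relation r:
   its points are the classes; a set of classes is open when their union is
   open in X, and functions are regular when their pullbacks are. *)
Section Quotient.
Variables (X : fspace C) (D : set (point X)) (r : point X -> point X -> Prop).

Definition quo_point : Type :=
  {O : set (point X) | exists2 x, D x & O = [set y | D y /\ r x y]}.

Definition quo_preimage (W : set quo_point) : set (point X) :=
  \bigcup_(O in W) sval O.

Definition quo_regular (W : set quo_point) (f : quo_point -> C) : Prop :=
  exists2 F : point X -> C, regular (quo_preimage W) F &
    forall O, W O -> forall x, sval O x -> F x = f O.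

Definition quotient_space : fspace C :=
  @FSpace C quo_point [set W | zopen (quo_preimage W)] quo_regular.

End Quotient.

(* P^a = (A^(a+1) \ 0) / C^* *)
Definition projective_space (a : nat) : fspace C :=
  @quotient_space (affine_space a.+1) [set v : 'rV[C]_a.+1 | v <> 0]
    (fun v w : 'rV[C]_a.+1 => exists2 c : C, c != 0 & w = c *: v).

(* The product of varieties.  [tensor U V] is the image of O(U) (x) O(V) in
   the functions on U x V; the basic open sets of X x Y are the sets
   {k <> 0} in U x V with k in tensor U V, and regular functions are locally
   of the form h / k with h, k in tensor U V. *)
Section Product.
Variables X Y : fspace C.

Definition tensor (U : set (point X)) (V : set (point Y))
    (h : point X * point Y -> C) : Prop :=
  exists (m : nat) (f : 'I_m -> point X -> C) (g : 'I_m -> point Y -> C),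
    [/\ forall k, regular U (f k), forall k, regular V (g k) &
        forall z, h z = \sum_(k < m) f k z.1 * g k z.2].

Definition nonvanishing (U : set (point X)) (V : set (point Y))
    (k : point X * point Y -> C) : set (point X * point Y) :=
  [set z | [/\ U z.1, V z.2 & k z != 0]].

Definition prod_open (W : set (point X * point Y)) : Prop :=
  forall z, W z -> exists U V k,
    [/\ zopen U, zopen V, tensor U V k &
        nonvanishing U V k z /\ nonvanishing U V k `<=` W].

Definition prod_regular (W : set (point X * point Y))
    (f : point X * point Y -> C) : Prop :=
  forall z, W z -> exists U V h k,
    [/\ zopen U, zopen V, tensor U V h, tensor U V k &
        [/\ nonvanishing U V k z, nonvanishing U V k `<=` W &
            forall w, nonvanishing U V k w -> f w = h w / k w]].

Definition prod_space : fspace C :=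
  @FSpace C (point X * point Y)%type prod_open prod_regular.

End Product.

(* phi restricts to a morphism from the open set U of X to the open set V
   of Y: it is continuous and pulls regular functions back to regular ones. *)
Definition morphism_on X Y (U : set (point X)) (V : set (point Y))
    (phi : point X -> point Y) : Prop :=
  (forall x, U x -> V (phi x)) /\
  forall W, zopen W -> W `<=` V ->
    zopen (U `&` phi @^-1` W) /\
    forall f, regular W f -> regular (U `&` phi @^-1` W) (f \o phi).

(* For irreducible varieties, such as V / G and V / G x P^a, non-empty open
   sets are dense. *)
Definition birational X Y : Prop :=
  exists (U : set (point X)) (V : set (point Y))
         (phi : point X -> point Y) (psi : point Y -> point X),
    [/\ zopen U /\ U !=set0, zopen V /\ V !=set0,
        morphism_on U V phi, morphism_on V U psi &
        (forall x, U x -> psi (phi x) = x) /\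
        (forall y, V y -> phi (psi y) = y)].

Definition stably_birational X Y : Prop :=
  exists a b : nat, birational (prod_space X (projective_space a))
                               (prod_space Y (projective_space b)).

(** * Linear quotients *)

Section LinearQuotient.
Variables (gT : finGroupType) (G : {group gT}) (n : nat).
Variable rG : mx_representation C G n.

(* A representation on V = C^n acts on row vectors by v |-> v *m rG g. *)

Definition generically_free : Prop :=
  exists U : set 'rV[C]_n,
    [/\ affine_open U, U !=set0 &
        forall v g, U v -> g \in G -> v *m rG g = v -> g = 1%g].

Definition linear_quotient : fspace C :=
  @quotient_space (affine_space n) setT
    (fun v w : 'rV[C]_n => exists2 g, g \in G & w = v *m rG g).

End LinearQuotient.
End FSpace.

(* Main.v *)
Require Import Defs.
From HB Require Import structures.
From mathcomp Require Import all_boot all_order all_algebra all_fingroup.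
From mathcomp Require Import all_solvable mxrepresentation.
From mathcomp Require Import boolp classical_sets reals complex.
From mathcomp Require Import separable algC cyclotomic classfun character ring.
From mathcomp Require mpoly.
Import (canonicals, coercions) mpoly.

Set Implicit Arguments.
Unset Strict Implicit.
Unset Printing Implicit Defensive.

Import Order.TTheory GRing.Theory Num.Theory.
(* Makes [point] denote the points of a space, not the base point of a pointed
   type. *)
Import Defs.

(** Write [G1] and [G2] for two finite groups.  The proof goes through
subgroups [K] of [G1 * G2] that project onto both factors and whose derived
subgroup contains no element with exactly one trivial coordinate.  For such
a [K], the group [[K, K]] is the graph of an isomorphism [[G1, G1] -> [G2, G2]],
and an element of [K] has a central first coordinate exactly when its second
coordinate is central, so [K] modulo the centers is the graph of an
isomorphism [G1 / Z1 -> G2 / Z2]; compatibility with commutators holds because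
[K] is a group.  Conversely an isoclinism is obtained from the [K] of all pairs
whose classes modulo the centers correspond ([isoclinic_of_graph],
[isoclinism_graph]).

Toroidal relations are homomorphisms on such a [K].  Let [K] be the fibre
product of two central extensions of [Q], let [f] be a homomorphism from [K] to
a torus [T], and put [i1 a = f (a, 1)], [i2 a = f (1, a)^-1].  Applying [f] to a
pair of sections [(s1, s2)] of the two extensions gives a cochain on [Q] whose
coboundary is [i1 c1 / i2 c2], where [c1], [c2] are the factor sets of [s1],
[s2].  Thus the two classes agree in [H^2(Q, T)].  If the extensions come from
an isoclinism, an embedding of the finite abelian group [K / [K, K]] into a
torus provides an [f] for which [i1] and [i2] are injective
([isoclinism_toroidally_related]).  In the other direction the embeddings and a
cochain that bounds [i1 c1 / i2 c2] recombine into such an [f]; it is trivial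
on [[K, K]] because [T] is abelian, which gives the condition on [K]
([toroidally_related_isoclinic]).

For the last part, let [K] act on both representations [V1] and [V2] through its
projections; the orbits, hence the quotients, do not change.  The kernel of [V1]
in [K] meets [[K, K]] trivially, so it is separated by linear characters of [K].
Adding one character [chi] to a representation [V] whose generic stabilizer
is its kernel does not change the stable class of the quotient: if [chi] maps
the kernel onto the group of [d]-th roots of unity, then
[(v, x) |-> (v, x ^ d / m v)] identifies [(V + chi) / K] birationally with
[(V / K) * A^1], for a semi-invariant [m] of weight [chi ^ d]
([character_untwist]).  So [V1] and [V2] may be replaced by generically free
representations [W1] and [W2] of the same group [K], and for those the classical
no-name lemma ([no_name]) compares both quotients with [(W1 + W2) / K].

All these maps are instances of one criterion, [linear_quotient_birational]:
a regular map between invariant open sets that matches orbits is birational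
on quotients as soon as invariant polynomials descend along it, because every
invariant regular function is locally a quotient of invariant polynomials
([invariant_fraction]).  All intermediate spaces are linear quotients; they are
irreducible, so birational maps compose.  The projective spaces are reached at
the two ends only, through the standard chart
([prod_projective_birational]). *)

(** * Linear characters *)

Section LinearCharacters.
Variables (C : fieldType) (gT : finGroupType) (G : {group gT}).
Local Open Scope ring_scope.

Definition linear_character (chi : gT -> C) : Prop :=
  chi 1%g = 1 /\ {in G &, forall g h, chi (g * h)%g = chi g * chi h}.

Lemma linear_character_neq0 chi g :
  linear_character chi -> g \in G -> chi g != 0.
Proof.
case=> chi1 chiM Gg; apply: contra_eq_neq chi1 => chig0.
by rewrite -(mulgV g) chiM ?groupV // chig0 mul0r eq_sym oner_neq0.
Qed.

Lemma linear_character_exp chi k :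
  linear_character chi -> linear_character (fun g => chi g ^+ k).
Proof.
case=> chi1 chiM; split=> [|g h Gg Gh]; first by rewrite chi1 expr1n.
by rewrite chiM // exprMn.
Qed.

End LinearCharacters.

Section EnoughCharacters.
Variable C : numClosedFieldType.
Local Open Scope ring_scope.

Lemma prim_root_exists n : (0 < n)%N -> exists z : C, n.-primitive_root z.
Proof.
pose p : {poly C} := 'X^n - 1; have [r Dp] := closed_field_poly_normal p.
move=> n_gt0; rewrite (monicP _) ?monicXnsubC // scale1r in Dp.
have rn1 : all n.-unity_root r by apply/allP=> z; rewrite -root_prod_XsubC -Dp.
have sz_r : (n < (size r).+1)%N.
  by rewrite -(size_prod_XsubC r id) -Dp size_XnsubC.
have [|z] := hasP (has_prim_root n_gt0 rn1 _ sz_r); last by exists z.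
by rewrite -separable_prod_XsubC -Dp separable_Xn_sub_1 // pnatr_eq0 -lt0n.
Qed.

(** The linear characters known from character theory take values in the
algebraic numbers.  Their values are roots of unity, so they are transported to
any algebraically closed field of characteristic zero by exchanging primitive
roots of unity of order the cardinal of the group. *)
Lemma enough_characters (gT : finGroupType) (G : {group gT}) :
  exists cs : seq (gT -> C),
    (forall k, (k < size cs)%N -> linear_character G (nth (fun=> 1) cs k)) /\
    forall g, g \in G ->
      (forall k, (k < size cs)%N -> nth (fun=> 1) cs k g = 1) -> g \in G^`(1)%g.
Proof.
have n_gt0 := cardG_gt0 G; set n := #|G| in n_gt0.
have [z prim_z] := C_prim_root_exists n_gt0.
have [w prim_w] := prim_root_exists n_gt0.
pose lg i g : nat := odflt (Ordinal n_gt0) [pick k : 'I_n | 'chi[G]_i g == z ^+ k].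
have lgE i g : 'chi[G]_i \is a linear_char -> g \in G -> 'chi_i g = z ^+ lg i g.
  move=> lin_i Gg; rewrite /lg; case: pickP => [k /eqP //|no_k].
  have : 'chi_i g ^+ n = 1 by rewrite -lin_charX // expg_cardG // lin_char1.
  by case/(prim_rootP prim_z) => k Dk; have := no_k k; rewrite Dk eqxx.
(* Both roots have order n, so an equality of powers reads the same in the two
   fields. *)
have lg_eq i g k : 'chi[G]_i \is a linear_char -> g \in G ->
    ('chi_i g == z ^+ k) = (w ^+ lg i g == w ^+ k).
  move=> lin_i Gg; rewrite (lgE i g lin_i Gg).
  by rewrite (eq_prim_root_expr prim_z) (eq_prim_root_expr prim_w).
pose L := [seq i <- enum {: Iirr G} | 'chi[G]_i \is a linear_char].
have memL i : i \in L = ('chi_i \is a linear_char).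
  by rewrite mem_filter mem_enum andbT.
exists [seq (fun g => w ^+ lg i g) | i <- L]; split=> [k|g Gg].
  rewrite size_map => ltk; rewrite (nth_map 0) //.
  have lin_k : 'chi_(nth 0 L k) \is a linear_char by rewrite -memL mem_nth.
  split=> [|g h Gg Gh].
    by apply/eqP; rewrite -(expr0 w) -lg_eq // lin_char1 ?expr0.
  rewrite -exprD; apply/eqP; rewrite -lg_eq ?groupM // lin_charM // exprD.
  by rewrite !(lgE _ _ lin_k).
move=> triv_g; rewrite -cap_cfker_lin_irr; apply/bigcapP => i lin_i.
rewrite cfkerEirr inE ?Gg /= lin_char1 // -(expr0 z) lg_eq // expr0; apply/eqP.
have Li : (index i L < size L)%N by rewrite index_mem memL.
have := triv_g (index i L); rewrite size_map (nth_map 0) // nth_index ?memL //.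
exact.
Qed.

End EnoughCharacters.

(** * Isoclinisms as subgroups of the product *)

Local Open Scope group_scope.

Section Graphs.
Variables gT1 gT2 : finGroupType.

Definition bijective_graph (H : {group gT1 * gT2})
    (A : {group gT1}) (B : {group gT2}) : Prop :=
  [/\ forall x, x \in H -> x.1 \in A /\ x.2 \in B,
      forall a, a \in A -> exists b, (a, b) \in H,
      forall b, b \in B -> exists a, (a, b) \in H &
      forall x, x \in H -> (x.1 == 1) = (x.2 == 1)].

Lemma graph_isom (H : {group gT1 * gT2}) (A : {group gT1}) (B : {group gT2}) :
  bijective_graph H A B ->
  exists2 f : {morphism A >-> gT2}, isom A B f &
    forall x, x \in H -> f x.1 = x.2.
Proof.
case=> HAB HA HB H1.
have Hfun a b b' : (a, b) \in H -> (a, b') \in H -> b = b'.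
  move=> Hb Hb'; have := H1 _ (groupM Hb (groupVr Hb')).
  by rewrite /= mulgV eqxx => /esym; rewrite -eq_mulgV1 => /eqP.
pose F (a : gT1) : gT2 := odflt 1 [pick b | (a, b) \in H].
have HF a : a \in A -> (a, F a) \in H.
  by case/HA=> b Hb; rewrite /F; case: pickP => // /(_ b); rewrite Hb.
have FM : {in A &, {morph F : a a' / a * a'}}.
  move=> a a' Aa Aa'; apply: (Hfun (a * a')); first exact/HF/groupM.
  exact: groupM (HF a Aa) (HF a' Aa').
have FE x : x \in H -> F x.1 = x.2.
  by case: x => a b Hx; have [Aa _] := HAB _ Hx; apply: Hfun (HF _ Aa) Hx.
exists (Morphism FM) => //; apply/isomP; split.
  apply/fintype.subsetP => a /morphpreP[Aa]; rewrite !inE /= => /eqP Fa1.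
  by have := H1 _ (HF a Aa); rewrite /= Fa1 eqxx.
apply/finset.setP => b; apply/morphimP/idP => [[a _ Aa ->]|Bb].
  by have [] := HAB _ (HF a Aa).
have [a Hab] := HB b Bb; exists a => //; first by have [] := HAB _ Hab.
  by have [] := HAB _ Hab.
by rewrite /= (FE _ Hab).
Qed.

(** The derived subgroup is only required to contain no element with a
single trivial coordinate; [derived_graph] and [center_quotient_graph] show that
this encodes both isomorphisms of an isoclinism. *)
Definition isoclinic_graph (K : {group gT1 * gT2})
    (G1 : {group gT1}) (G2 : {group gT2}) : Prop :=
  [/\ forall x, x \in K -> x.1 \in G1 /\ x.2 \in G2,
      forall g, g \in G1 -> exists g', (g, g') \in K,
      forall g', g' \in G2 -> exists g, (g, g') \in K &
      forall x, x \in [~: K, K] -> (x.1 == 1) = (x.2 == 1)].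

Variables (G1 : {group gT1}) (G2 : {group gT2}).

(** If the first coordinate of [x] is central, the commutator of [x] with any
element of [K] has a trivial first coordinate, hence a trivial second one. *)
Lemma isoclinic_graph_center (K : {group gT1 * gT2}) x :
  isoclinic_graph K G1 G2 -> x \in K -> (x.1 \in 'Z(G1)) = (x.2 \in 'Z(G2)).
Proof.
case=> KG K1 K2 KK Kx; have [G1x G2x] := KG x Kx.
apply/finset.setIP/finset.setIP => -[_ /centP cx]; split=> //; apply/centP => h Gh.
  have [g Kg] := K2 h Gh; have [G1g _] := KG _ Kg.
  have /KK : [~ x, (g, h)] \in [~: K, K] by apply: mem_commg.
  rewrite /= (introT commgP (cx g G1g)) => /esym/commgP; exact.
have [g Kg] := K1 h Gh; have [_ G2g] := KG _ Kg.
have /KK : [~ x, (h, g)] \in [~: K, K] by apply: mem_commg.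
rewrite /= (introT commgP (cx g G2g)) => /commgP; exact.
Qed.

Lemma isoclinic_graph_proj (K : {group gT1 * gT2}) :
  isoclinic_graph K G1 G2 -> fst @* K = G1 /\ snd @* K = G2.
Proof.
case=> KG K1 K2 _; split; apply/finset.setP => g.
  apply/morphimP/idP => [[x _ Kx ->]|/K1[g' Kg]]; first by have [] := KG x Kx.
  by exists (g, g').
apply/morphimP/idP => [[x _ Kx ->]|/K2[g' Kg]]; first by have [] := KG x Kx.
by exists (g', g).
Qed.

Lemma derived_graph (K : {group gT1 * gT2}) :
  isoclinic_graph K G1 G2 ->
  bijective_graph [~: K, K]%G [~: G1, G1]%G [~: G2, G2]%G.
Proof.
move=> isoK; have [fstK sndK] := isoclinic_graph_proj isoK.
have fstKK : fst @* [~: K, K] = [~: G1, G1].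
  by rewrite morphimR ?finset.subsetT ?fstK.
have sndKK : snd @* [~: K, K] = [~: G2, G2].
  by rewrite morphimR ?finset.subsetT ?sndK.
have [_ _ _ KK] := isoK.
split=> [x KKx|g|g|//].
- by rewrite /= -fstKK -sndKK !mem_morphim ?inE.
- by rewrite /= -fstKK => /morphimP[[a b] _ KKx /= ->]; exists b.
by rewrite /= -sndKK => /morphimP[[a b] _ KKx /= ->]; exists a.
Qed.

End Graphs.

Lemma commg_center (gT : finGroupType) (G : {group gT}) x y z w :
  x \in G -> y \in G -> z \in 'Z(G) -> w \in 'Z(G) ->
  [~ z * x, w * y] = [~ x, y].
Proof.
move=> Gx Gy /finset.setIP[Gz /centP cz] /finset.setIP[Gw /centP cw].
have c1 (u v : gT) : commute u v -> [~ u, v] = 1 by move=> cuv; apply/eqP/commgP.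
rewrite commMgJ (c1 _ _ (cz _ (groupM Gw Gy))) conj1g mul1g commgMJ.
by rewrite (c1 x w) ?conj1g ?mulg1 //; apply/commute_sym/cw.
Qed.

Section IsoclinismsAsGraphs.
Variables (gT1 gT2 : finGroupType) (G1 : {group gT1}) (G2 : {group gT2}).

Lemma center_quotient_graph (K : {group gT1 * gT2}) :
  isoclinic_graph K G1 G2 ->
  exists2 H : {group coset_of 'Z(G1) * coset_of 'Z(G2)},
    bijective_graph H (G1 / 'Z(G1))%G (G2 / 'Z(G2))%G &
    forall x, x \in K -> (coset 'Z(G1) x.1, coset 'Z(G2) x.2) \in H.
Proof.
move=> isoK; have KZ := isoclinic_graph_center isoK; case: isoK => KG K1 K2 KK.
have N1 x : x \in K -> x.1 \in 'N('Z(G1)).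
  by case/KG => G1x _; apply: fintype.subsetP G1x; apply/normal_norm/center_normal.
have N2 x : x \in K -> x.2 \in 'N('Z(G2)).
  by case/KG => _ G2x; apply: fintype.subsetP G2x; apply/normal_norm/center_normal.
pose q (x : gT1 * gT2) := (coset 'Z(G1) x.1, coset 'Z(G2) x.2).
have gH : group_set (q @: K).
  apply/group_setP; split=> [|_ _ /imsetP[x Kx ->] /imsetP[y Ky ->]].
    by apply/imsetP; exists 1; rewrite // /q /= !morph1.
  apply/imsetP; exists (x * y); first exact: groupM.
  by rewrite /q /= !morphM ?N1 ?N2.
exists (group gH) => [|x Kx]; last exact: imset_f.
split=> [_ /imsetP[x Kx ->]|a|b|_ /imsetP[x Kx ->]] /=.
- by have [G1x G2x] := KG x Kx; rewrite !mem_quotient.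
- case/morphimP=> g _ /K1[g' Kg] ->; exists (coset _ g').
  by apply/imsetP; exists (g, g').
- case/morphimP=> g' _ /K2[g Kg] ->; exists (coset _ g).
  by apply/imsetP; exists (g, g').
have c1 : (coset 'Z(G1) x.1 == 1) = (x.1 \in 'Z(G1)).
  by apply/eqP/idP => [/coset_idr|/coset_id //]; apply; apply: N1.
have c2 : (coset 'Z(G2) x.2 == 1) = (x.2 \in 'Z(G2)).
  by apply/eqP/idP => [/coset_idr|/coset_id //]; apply; apply: N2.
by rewrite c1 c2 KZ.
Qed.

Lemma isoclinic_of_graph (K : {group gT1 * gT2}) :
  isoclinic_graph K G1 G2 -> isoclinic G1 G2.
Proof.
move=> isoK; have [H graphH KH] := center_quotient_graph isoK.
have [f isof fE] := graph_isom graphH.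
have [d isod dE] := graph_isom (derived_graph isoK).
case: isoK => KG K1 K2 KK.
(* The representatives named in an isoclinism need not be related by K: they
   differ from related ones by central factors, which commutators ignore. *)
have shift g g' g'' : g' \in G2 -> (g, g'') \in K ->
    f (coset 'Z(G1) g) = coset 'Z(G2) g' -> exists2 z, z \in 'Z(G2) & g' = z * g''.
  move=> G2g' Kg; have [_ /= G2g''] := KG _ Kg; rewrite (fE _ (KH _ Kg)) /=.
  have nZ := fintype.subsetP (normal_norm (center_normal G2)).
  move/esym/rcoset_kercosetP => /(_ (nZ _ G2g') (nZ _ G2g'')).
  by case/rcosetP=> z Zz ->; exists z.
constructor; apply: (@Isoclinism _ _ _ _ f d isof isod).
move=> g h g' h' G1g G1h G2g' G2h' fg fh.
have [g'' Kg] := K1 g G1g; have [h'' Kh] := K1 h G1h.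
have [z Zz Dg'] := shift _ _ _ G2g' Kg fg; have [w Zw Dh'] := shift _ _ _ G2h' Kh fh.
have [_ G2g''] := KG _ Kg; have [_ G2h''] := KG _ Kh.
rewrite Dg' Dh' (commg_center (G := G2)) //.
have /dE : [~ (g, g''), (h, h'')] \in [~: K, K] by apply: mem_commg.
exact.
Qed.

Lemma isoclinism_graph (phi : isoclinism G1 G2) :
  exists2 K : {group gT1 * gT2}, isoclinic_graph K G1 G2 &
    forall x, x \in K <-> [/\ x.1 \in G1, x.2 \in G2 &
      iso_quo phi (coset 'Z(G1) x.1) = coset 'Z(G2) x.2].
Proof.
case: phi => f d isof isod fd /=.
pose S := [set x : gT1 * gT2 | [&& x.1 \in G1, x.2 \in G2 &
   f (coset 'Z(G1) x.1) == coset 'Z(G2) x.2]]%SET.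
have nZ1 := fintype.subsetP (normal_norm (center_normal G1)).
have nZ2 := fintype.subsetP (normal_norm (center_normal G2)).
have SP x : x \in S <-> [/\ x.1 \in G1, x.2 \in G2 &
    f (coset 'Z(G1) x.1) = coset 'Z(G2) x.2].
  by rewrite inE; split=> [/and3P[? ? /eqP]|[-> -> ->]]; rewrite ?eqxx.
have gS : group_set S.
  apply/group_setP; split=> [|x y /SP[G1x G2x fx] /SP[G1y G2y fy]]; apply/SP.
    by rewrite /= !group1 !morph1.
  rewrite /= !groupM //; split=> //.
  rewrite morphM ?nZ1 // morphM ?mem_quotient // morphM ?nZ2 //.
  by rewrite fx fy.
exists (group gS); last exact: SP.
split=> [x /SP[]//|g G1g|g' G2g'|].
- have : f (coset 'Z(G1) g) \in G2 / 'Z(G2).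
    by rewrite -(isom_im isof) mem_morphim ?mem_quotient.
  by case/morphimP=> g' _ G2g' fg; exists g'; apply/SP.
- have : coset 'Z(G2) g' \in f @* (G1 / 'Z(G1)) by rewrite (isom_im isof) mem_quotient.
  case/morphimP=> _ _ /morphimP[g _ G1g ->] fg; exists g; apply/SP.
  by split=> //=; rewrite -fg.
(* The commutators of K lie on the graph J of the isomorphism d, by the
   compatibility of d with commutators. *)
pose J := [set x : gT1 * gT2 | (x.1 \in [~: G1, G1]) && (d x.1 == x.2)]%SET.
have gJ : group_set J.
  apply/group_setP; split=> [|x y]; rewrite !inE /=.
    by rewrite group1 morph1 eqxx.
  move=> /andP[Gx /eqP dx] /andP[Gy /eqP dy]; rewrite groupM //=.
  by rewrite morphM // dx dy.
have sKJ : [~: group gS, group gS] \subset group gJ.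
  rewrite gen_subG; apply/fintype.subsetP => _ /imset2P[x y Sx Sy ->].
  have /SP[G1x G2x fx] := Sx; have /SP[G1y G2y fy] := Sy.
  rewrite inE /= mem_commg //=; apply/eqP; exact: fd.
move=> x /(fintype.subsetP sKJ); rewrite inE => /andP[Gx /eqP <-].
by rewrite -[in RHS](morph1 d) (inj_in_eq (injmP (isom_inj isod))).
Qed.

End IsoclinismsAsGraphs.

(** * Toroidal relations as homomorphisms to a torus *)

Section Torus.
Variables (R : rcfType) (r : nat).
Implicit Types t u : torus R r.

Definition torus_coord t (i : 'I_r) : R[i] := val ((t : {ffun 'I_r -> Cstar R}) i).

Lemma torus_coord_inj t u : torus_coord t =1 torus_coord u -> t = u.
Proof. by move=> eqtu; apply/ffunP => i; apply/val_inj/eqtu. Qed.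

Lemma torus_coordM t u i :
  torus_coord (t * u) i = (torus_coord t i * torus_coord u i)%R.
Proof. by rewrite /torus_coord ffunE. Qed.

Lemma torus_coordV t i : torus_coord t^-1 i = (torus_coord t i)^-1%R.
Proof. by rewrite /torus_coord ffunE. Qed.

Lemma torus_coord1 i : torus_coord (1 : torus R r) i = 1%R.
Proof. by rewrite /torus_coord ffunE. Qed.

Lemma torus_coord_neq0 t i : (torus_coord t i != 0)%R.
Proof. exact: valP ((t : {ffun 'I_r -> Cstar R}) i). Qed.

Lemma torus_mulgC t u : t * u = u * t.
Proof. by apply: torus_coord_inj => i; rewrite !torus_coordM mulrC. Qed.

Section Homomorphisms.
Variables (gT : finGroupType) (K : {group gT}) (f : gT -> torus R r).
Hypothesis fM : {in K &, forall x y, f (x * y) = f x * f y}.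

Lemma torus_hom1 : f 1 = 1.
Proof. by apply: (mulgI (f 1)); rewrite -fM ?group1 // !mulg1. Qed.

Lemma torus_homV x : x \in K -> f x^-1 = (f x)^-1.
Proof.
by move=> Kx; apply: (mulgI (f x)); rewrite -fM ?groupV // !mulgV torus_hom1.
Qed.

Lemma torus_hom_derived x : x \in [~: K, K] -> f x = 1.
Proof.
pose S := [set x in K | f x == 1]%SET.
have gS : group_set S.
  apply/group_setP; split=> [|y z]; rewrite !inE ?group1 ?torus_hom1 ?eqxx //.
  move=> /andP[Ky /eqP fy] /andP[Kz /eqP fz].
  by rewrite groupM // fM // fy fz mulg1 eqxx.
suff /fintype.subsetP sKS : [~: K, K] \subset group gS.
  by move/sKS; rewrite inE => /andP[_ /eqP].
rewrite gen_subG; apply/fintype.subsetP => _ /imset2P[y z Ky Kz ->].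
rewrite inE groupR //= commgEl conjgE !fM ?groupM ?groupV // !torus_homV //.
by rewrite (torus_mulgC (f y) (f z)) mulKg mulVg eqxx.
Qed.

End Homomorphisms.
End Torus.

Lemma torus_hom_exists (R : rcfType) (gT : finGroupType) (K : {group gT}) :
  exists (r : nat) (f : gT -> torus R r),
    {in K &, forall x y, f (x * y) = f x * f y} /\
    forall x, x \in K -> f x = 1 -> x \in [~: K, K].
Proof.
have [cs [lin_cs der_cs]] := enough_characters R[i] K.
pose chi (i : 'I_(size cs)) := nth (fun=> 1%R) cs i.
pose f x : torus R (size cs) := [ffun i => insubd (Cstar_one R) (chi i x)].
have fE x i : x \in K -> torus_coord (f x) i = chi i x.
  move=> Kx; rewrite /torus_coord ffunE val_insubd.
  by rewrite (linear_character_neq0 (lin_cs i _)).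
exists (size cs), f; split=> [x y Kx Ky|x Kx fx1].
  apply: torus_coord_inj => i; rewrite torus_coordM !fE ?groupM //.
  by have [_ chiM] := lin_cs i (ltn_ord i); apply: chiM.
rewrite -derg1; apply: der_cs => // k ltk.
by rewrite -[RHS](torus_coord1 R (Ordinal ltk)) -fx1 fE.
Qed.

Section Extensions.
Variables (aT gT qT : finGroupType).
Variables (A : {group aT}) (E : {group gT}) (Q : {group qT}).
Variable e : central_extension A E Q.
Local Notation p := (ext_prj e).
Local Notation j := (ext_inj e).

Definition ext_section (s : qT -> gT) : Prop :=
  {in Q, forall x, s x \in E /\ p (s x) = x}.

Lemma ext_prj_mem x : x \in E -> p x \in Q.
Proof. by move=> Ex; rewrite -(ext_surjective e) mem_morphim. Qed.

Lemma ext_inj_mem a : a \in A -> [/\ j a \in E, p (j a) = 1 &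
  forall x, x \in E -> j a * x = x * j a].
Proof.
move=> Aa; have jAa : j a \in j @* A by rewrite mem_morphim.
have /finset.setIP[Eja /centP cja] := fintype.subsetP (ext_central e) _ jAa.
split=> //.
by move: jAa; rewrite (ext_exact e) => /kerP; apply.
Qed.

Lemma ext_section_exists : exists s, ext_section s.
Proof.
exists (fun x => odflt 1 [pick g in E | p g == x]) => x Qx.
case: pickP => [g /andP[Eg /eqP pg] //|no_g].
move: Qx; rewrite -(ext_surjective e) => /morphimP[g _ Eg pg].
by have := no_g g; rewrite /= Eg pg eqxx.
Qed.

(** Every element of [E] is uniquely [j a * s q] with [a] in [A] and [q] in [Q];
the lemma provides the coordinate [a]. *)
Lemma ext_coordinate s : ext_section s -> exists al : gT -> aT,
  (forall x, x \in E -> al x \in A /\ x = j (al x) * s (p x)) /\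
  (forall a x, a \in A -> x \in E -> x = j a * s (p x) -> al x = a).
Proof.
move=> sec_s; exists (fun x => invm (ext_injective e) (x * (s (p x))^-1)).
split=> [x Ex|a x Aa Ex Dx]; last by rewrite {1}Dx mulgK invmE.
have [Es ps] := sec_s _ (ext_prj_mem Ex).
have /morphimP[a _ Aa Da] : x * (s (p x))^-1 \in j @* A.
  rewrite (ext_exact e); apply/kerP; rewrite ?groupM ?groupV //.
  by rewrite morphM ?groupV // morphV // ps mulgV.
by rewrite Da invmE // -Da mulgKV.
Qed.

Lemma factor_set_exists : exists s c, ext_section s /\
  {in Q &, forall x y, c x y \in A /\ s x * s y = j (c x y) * s (x * y)}.
Proof.
have [s sec_s] := ext_section_exists; have [al [alE _]] := ext_coordinate sec_s.
exists s, (fun x y => al (s x * s y)); split=> // x y Qx Qy.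
have [Ex px] := sec_s x Qx; have [Ey py] := sec_s y Qy.
have [Aal Dxy] := alE _ (groupM Ex Ey); split=> //.
by rewrite {1}Dxy morphM // px py.
Qed.

(** The group law of [E] in terms of the coordinate: the factor set measures how
far the coordinate is from being multiplicative. *)
Lemma ext_coordinateM s (al : gT -> aT) c : ext_section s ->
  {in Q &, forall x y, c x y \in A /\ s x * s y = j (c x y) * s (x * y)} ->
  (forall x, x \in E -> al x \in A /\ x = j (al x) * s (p x)) ->
  (forall a x, a \in A -> x \in E -> x = j a * s (p x) -> al x = a) ->
  {in E &, forall x y, al (x * y) = al x * al y * c (p x) (p y)}.
Proof.
move=> sec_s cE alE alU x y Ex Ey.
have [Aalx Dx] := alE x Ex; have [Aaly Dy] := alE y Ey.
have Qx := ext_prj_mem Ex; have Qy := ext_prj_mem Ey.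
have [Ac Dc] := cE _ _ Qx Qy; apply: alU; rewrite ?groupM //.
have [Esx _] := sec_s _ Qx; have [_ _ cy] := ext_inj_mem Aaly.
rewrite !morphM ?groupM // {1}Dx {1}Dy -!mulgA; congr (_ * _).
by rewrite (mulgA (s (p x))) -(cy _ Esx) -mulgA Dc.
Qed.

End Extensions.

Section ToroidalToIsoclinic.
Variables (R : rcfType) (aT1 gT1 aT2 gT2 qT : finGroupType).
Variables (A1 : {group aT1}) (E1 : {group gT1}).
Variables (A2 : {group aT2}) (E2 : {group gT2}) (Q : {group qT}).
Variables (e1 : central_extension A1 E1 Q) (e2 : central_extension A2 E2 Q).

(** On the fibre product, the coordinates along two sections fail to be
multiplicative by the factor sets [c1] and [c2]; a cochain [b] that bounds the
difference of their images in the torus corrects this, and makes [F] a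
homomorphism.  It restricts to [i1] and to the inverse of [i2] on the two
kernels, so its triviality on commutators forces the graph condition. *)
Lemma toroidally_related_isoclinic :
  toroidally_related R e1 e2 -> isoclinic E1 E2.
Proof.
case=> r [i1 [i2 [[i1M i1I] [i2M i2I] eqH]]].
have [s1 [c1 [sec1 c1E]]] := factor_set_exists e1.
have : H2_image e2 i2 (fun x y => i1 (c1 x y)).
  rewrite -eqH; exists c1; first by exists s1.
  exists (fun _ _ => 1); last by move=> x y _ _; rewrite mulg1.
  by exists (fun=> 1) => x y _ _; rewrite invg1 !mulg1.
case=> c2 [s2 [sec2 c2E]] [db [b bE] eqc].
have [al1 [al1E al1U]] := ext_coordinate sec1.
have [al2 [al2E al2U]] := ext_coordinate sec2.
have al1M := ext_coordinateM sec1 c1E al1E al1U.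
have al2M := ext_coordinateM sec2 c2E al2E al2U.
pose S := [set x : gT1 * gT2 | [&& x.1 \in E1, x.2 \in E2 &
  ext_prj e1 x.1 == ext_prj e2 x.2]]%SET.
have SP x : x \in S <->
    [/\ x.1 \in E1, x.2 \in E2 & ext_prj e1 x.1 = ext_prj e2 x.2].
  by rewrite inE; split=> [/and3P[? ? /eqP]|[-> -> ->]]; rewrite ?eqxx.
have gS : group_set S.
  apply/group_setP; split=> [|x y /SP[E1x E2x px] /SP[E1y E2y py]]; apply/SP.
    by rewrite /= !group1 !morph1.
  by rewrite /= !groupM // !morphM // px py.
pose F (x : gT1 * gT2) := i1 (al1 x.1) * (i2 (al2 x.2))^-1 * b (ext_prj e1 x.1).
have FM : {in group gS &, forall x y, F (x * y) = F x * F y}.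
  move=> x y /SP[E1x E2x px] /SP[E1y E2y py]; rewrite /F /=.
  have Qx : ext_prj e1 x.1 \in Q by exact: ext_prj_mem.
  have Qy : ext_prj e1 y.1 \in Q by exact: ext_prj_mem.
  have [Ax1 _] := al1E _ E1x; have [Ay1 _] := al1E _ E1y.
  have [Ax2 _] := al2E _ E2x; have [Ay2 _] := al2E _ E2y.
  have [Ac1 _] := c1E _ _ Qx Qy; have [Ac2 _] := c2E _ _ Qx Qy.
  rewrite al1M // al2M // -px -py morphM // !i1M ?groupM // !i2M ?groupM //.
  rewrite eqc // bE //; apply: torus_coord_inj => i.
  rewrite !(torus_coordM, torus_coordV).
  field; rewrite ?torus_coord_neq0 //.
have F1 := torus_hom_derived FM.
have FA1 a : a \in A1 -> F (ext_inj e1 a, 1) = i1 a.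
  move=> Aa; have [Eja pja cja] := ext_inj_mem e1 Aa.
  have [Aal1 D1] := al1E 1 (group1 _); rewrite morph1 in D1.
  have Dal : al1 (ext_inj e1 a) = a * al1 1.
    apply: al1U; rewrite ?groupM // pja morphM // -mulgA.
    by rewrite -D1 mulg1.
  have := torus_hom1 FM; rewrite /F /= Dal i1M // pja morph1 -!mulgA => ->.
  by rewrite mulg1.
have FA2 a : a \in A2 -> F (1, ext_inj e2 a) = (i2 a)^-1.
  move=> Aa; have [Eja pja cja] := ext_inj_mem e2 Aa.
  have [Aal1 D1] := al2E 1 (group1 _); rewrite morph1 in D1.
  have Dal : al2 (ext_inj e2 a) = a * al2 1.
    apply: al2U; rewrite ?groupM // pja morphM // -mulgA.
    by rewrite -D1 mulg1.
  rewrite -[RHS]mulg1 -(torus_hom1 FM) /F /= Dal i2M // !morph1.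
  apply: torus_coord_inj => i; rewrite !(torus_coordM, torus_coordV).
  field; rewrite ?torus_coord_neq0 //.
have i1_1 : i1 1 = 1 by apply: (mulgI (i1 1)); rewrite -i1M // !mulg1.
have i2_1 : i2 1 = 1 by apply: (mulgI (i2 1)); rewrite -i2M // !mulg1.
apply: (@isoclinic_of_graph _ _ _ _ (group gS)); split.
- by move=> x /SP[].
- move=> g Eg; have [Es ps] := sec2 _ (ext_prj_mem e1 Eg).
  by exists (s2 (ext_prj e1 g)); apply/SP.
- move=> g Eg; have [Es ps] := sec1 _ (ext_prj_mem e2 Eg).
  by exists (s1 (ext_prj e2 g)); apply/SP.
move=> [x y] KKxy; have Fxy := F1 _ KKxy.
have /SP[/= E1x E2y pxy] : (x, y) \in group gS.
  by apply: fintype.subsetP KKxy; rewrite -derg1 der_sub.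
apply/eqP/eqP => [x1|y1]; subst.
  have : y \in ext_inj e2 @* A2.
    by rewrite (ext_exact e2); apply/kerP; rewrite // -pxy morph1.
  case/morphimP=> a _ Aa Dy; move: Fxy; rewrite Dy FA2 // => /(congr1 (@invg _)).
  rewrite invgK invg1 -i2_1 => /(i2I _ _ Aa (group1 _)) ->.
  exact: morph1.
have : x \in ext_inj e1 @* A1.
  by rewrite (ext_exact e1); apply/kerP; rewrite // pxy morph1.
case/morphimP=> a _ Aa Dx; move: Fxy; rewrite Dx FA1 // -i1_1.
by move=> /(i1I _ _ Aa (group1 _)) ->; exact: morph1.
Qed.

End ToroidalToIsoclinic.

Lemma pair_mulg (gT1 gT2 : finGroupType) (x1 y1 : gT1) (x2 y2 : gT2) :
  (x1, x2) * (y1, y2) = (x1 * y1, x2 * y2).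
Proof. by []. Qed.

Section IsoclinicToToroidal.
Variables (R : rcfType) (aT1 gT1 aT2 gT2 qT : finGroupType).
Variables (A1 : {group aT1}) (E1 : {group gT1}).
Variables (A2 : {group aT2}) (E2 : {group gT2}) (Q : {group qT}).
Variables (e1 : central_extension A1 E1 Q) (e2 : central_extension A2 E2 Q).

(** An element of either side comes from a factor set of one extension; comparing
this factor set with any factor set of the other extension puts the element in
the other side. *)
Lemma H2_image_eq r (i1 : aT1 -> torus R r) (i2 : aT2 -> torus R r) :
  (forall c1 c2, factor_set e1 c1 -> factor_set e2 c2 ->
     coboundary2 Q (fun x y => i1 (c1 x y) * (i2 (c2 x y))^-1)) ->
  H2_image e1 i1 = H2_image e2 i2.
Proof.
move=> cobd; apply/seteqP; split=> c [].
  move=> c1 fs1 [d [b bE] cE].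
  have [s2 [c2 [sec2 c2E]]] := factor_set_exists e2.
  have fs2 : factor_set e2 c2 by exists s2.
  have [b' b'E] := cobd c1 c2 fs1 fs2.
  exists c2 => //; exists (fun x y => (i2 (c2 x y))^-1 * c x y).
    exists (fun x => b x * b' x) => x y Qx Qy; rewrite cE // bE //.
    have := b'E x y Qx Qy => e12; apply: torus_coord_inj => i.
    move/(congr1 (fun t => torus_coord t i)): e12.
    rewrite !(torus_coordM, torus_coordV) => e12.
    rewrite mulrA (mulrC _^-1%R) e12; field; rewrite ?torus_coord_neq0 //.
  by move=> x y _ _; rewrite mulKVg.
move=> c2 fs2 [d [b bE] cE]; have [s1 [c1 [sec1 c1E]]] := factor_set_exists e1.
have fs1 : factor_set e1 c1 by exists s1.
have [b' b'E] := cobd c1 c2 fs1 fs2.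
exists c1 => //; exists (fun x y => (i1 (c1 x y))^-1 * c x y).
  exists (fun x => b x * (b' x)^-1) => x y Qx Qy; rewrite cE // bE //.
  have := b'E x y Qx Qy => e12; apply: torus_coord_inj => i.
  move/(congr1 (fun t => (torus_coord t i)^-1)%R): e12.
  rewrite !(torus_coordM, torus_coordV) invfM invrK => e12.
  rewrite mulrA e12; field; rewrite ?torus_coord_neq0 //.
by move=> x y _ _; rewrite mulKVg.
Qed.

(** The embeddings are the restrictions of [f] to the kernels of the two
projections, the second one inverted; the required cochain is [f] on a pair of
sections. *)
Lemma toroidally_related_of_hom (K : {group gT1 * gT2}) r
    (f : gT1 * gT2 -> torus R r) :
  (forall x y, x \in E1 -> y \in E2 -> ext_prj e1 x = ext_prj e2 y ->
     (x, y) \in K) ->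
  {in K &, forall x y, f (x * y) = f x * f y} ->
  (forall x, x \in K -> f x = 1 -> (x.1 == 1) = (x.2 == 1)) ->
  toroidally_related R e1 e2.
Proof.
move=> memK fM f1.
have K1 a : a \in A1 -> (ext_inj e1 a, 1) \in K.
  move=> Aa; have [Ea pa _] := ext_inj_mem e1 Aa.
  by apply: memK; rewrite ?group1 // pa morph1.
have K2 a : a \in A2 -> (1, ext_inj e2 a) \in K.
  move=> Aa; have [Ea pa _] := ext_inj_mem e2 Aa.
  by apply: memK; rewrite ?group1 // pa morph1.
exists r, (fun a => f (ext_inj e1 a, 1)), (fun a => (f (1, ext_inj e2 a))^-1); split.
- split=> [a b Aa Ab|a b Aa Ab eqf].
    by rewrite -fM ?K1 // pair_mulg mulg1 morphM.
  have Kab := groupM (K1 a Aa) (groupVr (K1 b Ab)).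
  have /(f1 _ Kab) : f ((ext_inj e1 a, 1) * (ext_inj e1 b, 1)^-1) = 1.
    by rewrite fM ?groupV ?K1 // (torus_homV fM) ?K1 // eqf mulgV.
  rewrite /= invg1 mulg1 eqxx -eq_mulgV1 => /eqP.
  exact: (injmP (ext_injective e1)).
- split=> [a b Aa Ab|a b Aa Ab /invg_inj eqf].
    rewrite -invMg -fM ?K2 //; congr (f _)^-1.
    have [Eja _ cja] := ext_inj_mem e2 Aa; have [Ejb _ _] := ext_inj_mem e2 Ab.
    by rewrite pair_mulg mulg1 morphM // cja.
  have Kab := groupM (K2 a Aa) (groupVr (K2 b Ab)).
  have /(f1 _ Kab) : f ((1, ext_inj e2 a) * (1, ext_inj e2 b)^-1) = 1.
    by rewrite fM ?groupV ?K2 // (torus_homV fM) ?K2 // eqf mulgV.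
  rewrite /= invg1 mulg1 eqxx -eq_mulgV1 => /esym/eqP.
  exact: (injmP (ext_injective e2)).
apply: H2_image_eq => c1 c2 [s1 [sec1 c1E]] [s2 [sec2 c2E]].
exists (fun x => f (s1 x, s2 x)) => x y Qx Qy; rewrite invgK.
have Ks z : z \in Q -> (s1 z, s2 z) \in K.
  move=> Qz; have [Es1 ps1] := sec1 z Qz; have [Es2 ps2] := sec2 z Qz.
  by apply: memK; rewrite // ps1 ps2.
have [Ac1 D1] := c1E x y Qx Qy; have [Ac2 D2] := c2E x y Qx Qy.
apply: (canRL (mulgK _)); rewrite -!fM ?groupM ?Ks ?K1 ?K2 ?groupM //.
by rewrite !pair_mulg D1 D2 mulg1 mul1g.
Qed.

End IsoclinicToToroidal.

Lemma isoclinism_toroidally_related (R : rcfType) (gT1 gT2 : finGroupType)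
    (G1 : {group gT1}) (G2 : {group gT2}) (phi : isoclinism G1 G2) :
  toroidally_related R (center_extension G1)
    (transport_extension (center_extension G2) (isom_sym (iso_quo_isom phi))).
Proof.
have [K [KG K1 K2 KK] KP] := isoclinism_graph phi.
have [r [f [fM f1]]] := torus_hom_exists R K.
apply: (@toroidally_related_of_hom _ _ _ _ _ _ _ _ _ _ _ _ _ K r f) => //.
  move=> x y G1x G2y /= eqxy; apply/KP; split=> //=.
  have G1Zx : coset 'Z(G1) x \in G1 / 'Z(G1) by rewrite mem_quotient.
  have G2Zy : coset 'Z(G2) y \in iso_quo phi @* (G1 / 'Z(G1)).
    by rewrite (isom_im (iso_quo_isom phi)) mem_quotient.
  have -> : coset 'Z(G1) x = invm (isom_inj (iso_quo_isom phi)) (coset 'Z(G2) y).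
    exact: eqxy.
  by rewrite invmK.
by move=> x Kx /(f1 x Kx)/KK.
Qed.

(** * Polynomial and regular functions on affine space *)

Local Open Scope classical_set_scope.
Local Open Scope ring_scope.

Section PolynomialFunctions.
Variable C : fieldType.

(** Working with functions instead of formal polynomials gives closure under
composition with polynomial maps by induction; [polyfunP] identifies them with
the evaluations of formal polynomials. *)
Inductive polyfun n : ('rV[C]_n -> C) -> Prop :=
| polyfun_cst c : polyfun (fun=> c)
| polyfun_coord i : polyfun (fun v => v 0 i)
| polyfun_add f g : polyfun f -> polyfun g -> polyfun (fun v => f v + g v)
| polyfun_mul f g : polyfun f -> polyfun g -> polyfun (fun v => f v * g v).

Definition polymap n m (q : 'rV[C]_n -> 'rV[C]_m) : Prop :=
  forall j, polyfun (fun v => q v 0 j).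

Lemma polyfun_ext n (f g : 'rV[C]_n -> C) : f =1 g -> polyfun f -> polyfun g.
Proof. by move=> /funext->. Qed.

Lemma polyfun_sum n (I : Type) (r : seq I) (P : pred I)
    (F : I -> 'rV[C]_n -> C) :
  (forall i, polyfun (F i)) -> polyfun (fun v => \sum_(i <- r | P i) F i v).
Proof.
move=> FP; elim: r => [|i r IHr].
  by apply: polyfun_ext (polyfun_cst n 0) => v; rewrite big_nil.
case Pi: (P i); last by apply: polyfun_ext IHr => v; rewrite big_cons Pi.
by apply: polyfun_ext (polyfun_add (FP i) IHr) => v; rewrite big_cons Pi.
Qed.

Lemma polyfun_prod n (I : Type) (r : seq I) (P : pred I)
    (F : I -> 'rV[C]_n -> C) :
  (forall i, polyfun (F i)) -> polyfun (fun v => \prod_(i <- r | P i) F i v).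
Proof.
move=> FP; elim: r => [|i r IHr].
  by apply: polyfun_ext (polyfun_cst n 1) => v; rewrite big_nil.
case Pi: (P i); last by apply: polyfun_ext IHr => v; rewrite big_cons Pi.
by apply: polyfun_ext (polyfun_mul (FP i) IHr) => v; rewrite big_cons Pi.
Qed.

Lemma polyfun_exp n (f : 'rV[C]_n -> C) k :
  polyfun f -> polyfun (fun v => f v ^+ k).
Proof.
move=> Pf; apply: polyfun_ext (polyfun_prod (index_enum 'I_k) xpredT (fun=> Pf)).
by move=> v /=; rewrite prodr_const card_ord.
Qed.

Lemma polyfunP n (f : 'rV[C]_n -> C) :
  polyfun f <-> exists p : mpoly.mpoly n C, f = peval p.
Proof.
split=> [|[p ->]].
  elim=> [c|i|{}f g _ [p ->] _ [q ->]|{}f g _ [p ->] _ [q ->]].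
  - by exists (mpoly.mpolyC n c); apply: funext => v; rewrite /peval mpoly.mevalC.
  - exists (mpoly.mpolyX C (mpoly.mnm1 i)); apply: funext => v.
    by rewrite /peval mpoly.mevalXU.
  - by exists (p + q); apply: funext => v; rewrite /peval mpoly.mevalD.
  - by exists (p * q); apply: funext => v; rewrite /peval mpoly.mevalM.
rewrite /peval; elim/mpoly.mpolyind: p => [|c m p _ _ IHp].
  by apply: polyfun_ext (polyfun_cst n 0) => v; rewrite mpoly.meval0.
pose mono (v : 'rV[C]_n) := \prod_(i < n) v 0 i ^+ m i.
have Pmono : polyfun mono.
  by apply: polyfun_prod => i; apply/polyfun_exp/polyfun_coord.
apply: polyfun_ext (polyfun_add (polyfun_mul (polyfun_cst n c) Pmono) IHp) => v.
by rewrite /= mpoly.mevalD mpoly.mevalZ mpoly.mevalX.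
Qed.

Lemma polyfun_comp n m (q : 'rV[C]_n -> 'rV[C]_m) f :
  polymap q -> polyfun f -> polyfun (fun v => f (q v)).
Proof.
move=> Pq; elim=> [c|i|{}f g _ Pf _ Pg|{}f g _ Pf _ Pg].
- exact: polyfun_cst.
- exact: Pq.
- exact: polyfun_add.
- exact: polyfun_mul.
Qed.

Lemma polymap_comp n m l (q : 'rV[C]_n -> 'rV[C]_m) (s : 'rV[C]_m -> 'rV[C]_l) :
  polymap q -> polymap s -> polymap (fun v => s (q v)).
Proof. by move=> Pq Ps j; apply: polyfun_comp (Ps j). Qed.

Lemma polymap_id n : polymap (@id 'rV[C]_n).
Proof. by move=> j; apply: polyfun_coord. Qed.

Lemma polymap_mulmx n m (A : 'M[C]_(n, m)) : polymap (fun v => v *m A).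
Proof.
move=> j; have PF i : polyfun (fun v : 'rV[C]_n => v 0 i * A i j).
  exact: polyfun_mul (polyfun_coord i) (polyfun_cst _ _).
apply: polyfun_ext (polyfun_sum (index_enum 'I_n) xpredT PF) => v.
by rewrite mxE.
Qed.

Lemma polymap_lsubmx n m : polymap (@lsubmx C 1 n m).
Proof.
by move=> j; apply: polyfun_ext (polyfun_coord (lshift m j)) => v; rewrite mxE.
Qed.

Lemma polymap_rsubmx n m : polymap (@rsubmx C 1 n m).
Proof.
by move=> j; apply: polyfun_ext (polyfun_coord (rshift n j)) => v; rewrite mxE.
Qed.

Lemma polymap_row_mx n m l (q : 'rV[C]_n -> 'rV[C]_m) (s : 'rV[C]_n -> 'rV[C]_l) :
  polymap q -> polymap s -> polymap (fun v => row_mx (q v) (s v)).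
Proof.
move=> Pq Ps j; rewrite -(splitK j); case: (fintype.split j) => k /=.
  by apply: polyfun_ext (Pq k) => v; rewrite row_mxEl.
by apply: polyfun_ext (Ps k) => v; rewrite row_mxEr.
Qed.

Lemma polyfun_det n m (M : 'rV[C]_n -> 'M[C]_m) :
  (forall i j, polyfun (fun v => M v i j)) -> polyfun (fun v => \det (M v)).
Proof.
move=> PM; apply: polyfun_sum => s; apply: polyfun_mul (polyfun_cst _ _) _.
by apply: polyfun_prod => i; apply: PM.
Qed.

Lemma polyfun_adj n m (M : 'rV[C]_n -> 'M[C]_m) i j :
  (forall i j, polyfun (fun v => M v i j)) -> polyfun (fun v => (\adj (M v)) i j).
Proof.
move=> PM; apply: (@polyfun_ext _ (fun v => (-1) ^+ (j + i) *
    \det (row' j (col' i (M v))))) => [v|]; first by rewrite mxE.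
apply: polyfun_mul (polyfun_cst _ _) _; apply: polyfun_det => k l.
by apply: polyfun_ext (PM (lift j k) (lift i l)) => v; rewrite !mxE.
Qed.

Lemma polyfun_curve n (l : 'I_n -> {poly C}) f :
  polyfun f -> exists p : {poly C}, forall t, f (\row_i (l i).[t]) = p.[t].
Proof.
elim=> [c|i|{}f g _ [p fp] _ [q gq]|{}f g _ [p fp] _ [q gq]].
- by exists c%:P => t; rewrite hornerC.
- by exists (l i) => t; rewrite mxE.
- by exists (p + q) => t; rewrite hornerD fp gq.
- by exists (p * q) => t; rewrite hornerM fp gq.
Qed.

Lemma polyfun_separate n (v0 : 'rV[C]_n) (s : seq 'rV[C]_n) :
  exists p, [/\ polyfun p, p v0 != 0 &
    forall w, w \in s -> w != v0 -> p w = 0].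
Proof.
elim: s => [|w s [p [Pp p0 ps]]].
  by exists (fun=> 1); split=> //; [apply: polyfun_cst | apply: oner_neq0].
have [eq_wv0|neq_wv0] := eqVneq w v0.
  exists p; split=> // u; rewrite inE => /predU1P[->|]; last exact: ps.
  by rewrite eq_wv0 eqxx.
have [i neq_i] : exists i, v0 0 i != w 0 i.
  apply/existsP; apply: contraR neq_wv0 => /existsPn eq_vw.
  by apply/eqP/rowP => i; apply/esym/eqP/negPn/eq_vw.
exists (fun v => p v * (v 0 i + - w 0 i)); split=> [||u].
- exact: polyfun_mul (polyfun_add (polyfun_coord i) (polyfun_cst _ _)).
- by rewrite mulf_neq0 // subr_eq0.
rewrite inE => /predU1P[-> _|us uv0]; first by rewrite subrr mulr0.
by rewrite ps ?mul0r.
Qed.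

Lemma affine_openP n (U : set 'rV[C]_n) :
  affine_open U <-> forall v, U v ->
    exists p, [/\ polyfun p, p v != 0 & forall w, p w != 0 -> U w].
Proof.
split=> [[S ->] v [p Sp pv]|openU].
  exists (peval p); split=> // [|w pw]; first by apply/polyfunP; exists p.
  by exists p.
exists [set p | forall w, peval p w != 0 -> U w]; apply/seteqP; split=> [v Uv|v].
  have [f [/polyfunP[p ->] pv pU]] := openU v Uv.
  by exists p.
by case=> p /= pU; apply: pU.
Qed.

Lemma affine_openT n : affine_open [set: 'rV[C]_n].
Proof.
apply/affine_openP => v _; exists (fun=> 1).
by split=> //; [apply: polyfun_cst | apply: oner_neq0].
Qed.

Lemma affine_openI n (U V : set 'rV[C]_n) :
  affine_open U -> affine_open V -> affine_open (U `&` V).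
Proof.
move=> /affine_openP oU /affine_openP oV; apply/affine_openP => v [Uv Vv].
have [p [Pp pv pU]] := oU v Uv; have [q [Pq qv qV]] := oV v Vv.
exists (fun w => p w * q w); split=> [||w].
- exact: polyfun_mul.
- exact: mulf_neq0.
- by rewrite mulf_eq0 negb_or => /andP[/pU Uw /qV Vw].
Qed.

Lemma affine_open_nz n f : @polyfun n f -> affine_open [set v | f v != 0].
Proof. by move=> Pf; apply/affine_openP => v fv; exists f. Qed.

(** A local fraction [p / q] on a neighbourhood given by [h] becomes [p h / q h],
whose denominator vanishes off that neighbourhood.  The identity [f q = p] then
holds on all of [U], so that such identities may be transported by a group
and summed. *)
Lemma affine_regularP n (U : set 'rV[C]_n) (f : 'rV[C]_n -> C) :
  affine_regular U f <-> forall v, U v -> exists p q,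
    [/\ polyfun p, polyfun q, q v != 0,
        forall w, q w != 0 -> U w &
        forall w, U w -> f w * q w = p w].
Proof.
split=> [regf v Uv|regf v Uv].
  have [W [p [q [/affine_openP oW Wv WU fW]]]] := regf v Uv.
  have [h [Ph hv hW]] := oW v Wv.
  have [Pp Pq] : polyfun (peval p) /\ polyfun (peval q).
    by split; apply/polyfunP; [exists p | exists q].
  exists (fun w => peval p w * h w), (fun w => peval q w * h w); split.
  - exact: polyfun_mul.
  - exact: polyfun_mul.
  - by rewrite mulf_neq0 //; case: (fW v Wv).
  - by move=> w; rewrite mulf_eq0 negb_or => /andP[_ /hW /WU].
  move=> w Uw; have [->|/hW/fW[qw ->]] := eqVneq (h w) 0; first by rewrite !mulr0.
  by rewrite mulrA divfK.
have [_ [_ [/polyfunP[p ->] /polyfunP[q ->] qv qU fU]]] := regf v Uv.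
exists [set w | peval q w != 0], p, q; split=> //.
  by apply: affine_open_nz; apply/polyfunP; exists q.
by move=> w /= qw; split=> //; rewrite -fU ?mulfK //; apply: qU.
Qed.

Lemma affine_regular_open n (U : set 'rV[C]_n) f :
  affine_regular U f -> affine_open U.
Proof.
move=> /affine_regularP regf; apply/affine_openP => v Uv.
by have [p [q [_ Pq qv qU _]]] := regf v Uv; exists q.
Qed.

Lemma affine_regular_ext n (U : set 'rV[C]_n) f g :
  (forall v, U v -> f v = g v) -> affine_regular U f -> affine_regular U g.
Proof.
move=> eqfg /affine_regularP regf; apply/affine_regularP => v Uv.
have [p [q [Pp Pq qv qU fU]]] := regf v Uv; exists p, q; split=> // w Uw.
by rewrite -eqfg // fU.
Qed.

Lemma affine_regular_local n (U : set 'rV[C]_n) f :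
  (forall v, U v -> exists W, [/\ affine_regular W f, W v & W `<=` U]) ->
  affine_regular U f.
Proof.
move=> loc v Uv; have [W [regf Wv WU]] := loc v Uv.
have [W' [p [q [oW' W'v W'W fW']]]] := regf v Wv.
by exists W', p, q; split=> // w /W'W/WU.
Qed.

Lemma affine_regular_sub n (U W : set 'rV[C]_n) f :
  affine_open W -> W `<=` U -> affine_regular U f -> affine_regular W f.
Proof.
move=> oW WU regf v Wv; have [W' [p [q [oW' W'v W'U fW']]]] := regf v (WU v Wv).
exists (W `&` W'), p, q; split=> //; first exact: affine_openI.
by move=> w [_ /fW'].
Qed.

Lemma affine_regular_polyfun n (U : set 'rV[C]_n) f :
  affine_open U -> polyfun f -> affine_regular U f.
Proof.
move=> /affine_openP oU Pf; apply/affine_regularP => v /oU[q [Pq qv qU]].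
exists (fun w => f w * q w), q; split=> //; exact: polyfun_mul.
Qed.

Lemma affine_regular_add n (U : set 'rV[C]_n) f g :
  affine_regular U f -> affine_regular U g -> affine_regular U (fun v => f v + g v).
Proof.
move=> /affine_regularP regf /affine_regularP regg; apply/affine_regularP => v Uv.
have [p [q [Pp Pq qv qU fU]]] := regf v Uv.
have [p' [q' [Pp' Pq' qv' qU' gU]]] := regg v Uv.
exists (fun v => p v * q' v + p' v * q v), (fun v => q v * q' v); split.
- exact: polyfun_add (polyfun_mul _ _) (polyfun_mul _ _).
- exact: polyfun_mul.
- exact: mulf_neq0.
- by move=> w; rewrite mulf_eq0 negb_or => /andP[/qU].
move=> w Uw; rewrite -fU // -gU // mulrDl; congr (_ + _); first exact: mulrA.
by rewrite -!mulrA; congr (_ * _); apply: mulrC.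
Qed.

Lemma affine_regular_mul n (U : set 'rV[C]_n) f g :
  affine_regular U f -> affine_regular U g -> affine_regular U (fun v => f v * g v).
Proof.
move=> /affine_regularP regf /affine_regularP regg; apply/affine_regularP => v Uv.
have [p [q [Pp Pq qv qU fU]]] := regf v Uv.
have [p' [q' [Pp' Pq' qv' qU' gU]]] := regg v Uv.
exists (fun v => p v * p' v), (fun v => q v * q' v); split.
- exact: polyfun_mul.
- exact: polyfun_mul.
- exact: mulf_neq0.
- by move=> w; rewrite mulf_eq0 negb_or => /andP[/qU].
by move=> w Uw; rewrite -fU // -gU // mulrACA.
Qed.

Lemma affine_regular_sum n (U : set 'rV[C]_n) m (F : 'I_m -> 'rV[C]_n -> C) :
  affine_open U -> (forall i, affine_regular U (F i)) ->
  affine_regular U (fun v => \sum_i F i v).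
Proof.
move=> oU regF; elim: (index_enum _) => [|i r IHr].
  apply: (affine_regular_ext (f := fun=> 0)) => [v _|]; first by rewrite big_nil.
  exact: affine_regular_polyfun (polyfun_cst n 0).
apply: affine_regular_ext (affine_regular_add (regF i) IHr) => v _.
by rewrite big_cons.
Qed.

Lemma affine_regular_nz n (U : set 'rV[C]_n) f :
  affine_regular U f -> affine_open (U `&` [set v | f v != 0]).
Proof.
move=> /affine_regularP regf; apply/affine_openP => v [Uv fv].
have [p [q [Pp Pq qv qU fU]]] := regf v Uv.
exists (fun w => p w * q w); split=> [||w].
- exact: polyfun_mul.
- by rewrite -fU // !mulf_neq0.
rewrite mulf_eq0 negb_or => /andP[pw /qU Uw]; split=> //.
by move: pw; rewrite -fU // mulf_eq0 negb_or => /andP[].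
Qed.

Lemma affine_regular_inv n (U : set 'rV[C]_n) f :
  affine_regular U f ->
  affine_regular (U `&` [set v | f v != 0]) (fun v => (f v)^-1).
Proof.
move=> /affine_regularP regf; apply/affine_regularP => v [Uv fv].
have [p [q [Pp Pq qv qU fU]]] := regf v Uv.
exists (fun w => q w * q w), (fun w => p w * q w); split=> [||||w [Uw fw]].
- exact: polyfun_mul.
- exact: polyfun_mul.
- by rewrite -fU // !mulf_neq0.
- move=> w; rewrite mulf_eq0 negb_or => /andP[pw /qU Uw]; split=> //.
  by move: pw; rewrite -fU // mulf_eq0 negb_or => /andP[].
- by rewrite -fU // mulrA mulrA mulVf // mul1r.
Qed.

Definition regular_map n m (U : set 'rV[C]_n) (q : 'rV[C]_n -> 'rV[C]_m) :=
  forall j, affine_regular U (fun v => q v 0 j).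

Lemma regular_map_polymap n m U (q : 'rV[C]_n -> 'rV[C]_m) :
  affine_open U -> polymap q -> regular_map U q.
Proof. by move=> oU Pq j; apply: affine_regular_polyfun. Qed.

Lemma regular_map_row_mx n m l U (q : 'rV[C]_n -> 'rV[C]_m)
    (s : 'rV[C]_n -> 'rV[C]_l) :
  regular_map U q -> regular_map U s ->
  regular_map U (fun v => row_mx (q v) (s v)).
Proof.
move=> Pq Ps j; rewrite -(splitK j); case: (fintype.split j) => k /=.
  by apply: affine_regular_ext (Pq k) => v _; rewrite row_mxEl.
by apply: affine_regular_ext (Ps k) => v _; rewrite row_mxEr.
Qed.

Lemma polyfun_comp_regular n m U (q : 'rV[C]_n -> 'rV[C]_m) f :
  affine_open U -> regular_map U q -> polyfun f ->
  affine_regular U (fun v => f (q v)).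
Proof.
move=> oU Pq; elim=> [c|i|{}f g _ Pf _ Pg|{}f g _ Pf _ Pg].
- exact: affine_regular_polyfun (polyfun_cst _ _).
- exact: Pq.
- exact: affine_regular_add.
- exact: affine_regular_mul.
Qed.

Lemma regular_map_open n m U W (q : 'rV[C]_n -> 'rV[C]_m) :
  affine_open U -> regular_map U q -> affine_open W ->
  affine_open (U `&` [set v | W (q v)]).
Proof.
move=> oU Pq /affine_openP oW; apply/affine_openP => v [Uv /oW[p [Pp pv pW]]].
have /affine_openP/(_ v (conj Uv pv))[h [Ph hv hU]] :=
  affine_regular_nz (polyfun_comp_regular oU Pq Pp).
by exists h; split=> // w /hU[Uw /pW].
Qed.

Lemma regular_comp n m U W (q : 'rV[C]_n -> 'rV[C]_m) f :
  affine_open U -> regular_map U q -> affine_regular W f ->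
  affine_regular (U `&` [set v | W (q v)]) (fun v => f (q v)).
Proof.
move=> oU Pq regf; have oW := affine_regular_open regf.
have oUW := regular_map_open oU Pq oW.
move/affine_regularP: regf => regf; apply: affine_regular_local => v [Uv Wv].
have [p [r [Pp Pr rv rW fW]]] := regf _ Wv.
have regrq := polyfun_comp_regular oU Pq Pr.
have regpq := polyfun_comp_regular oU Pq Pp.
exists (U `&` [set v | r (q v) != 0]); split=> //.
  apply: affine_regular_ext (affine_regular_mul
    (affine_regular_sub (affine_regular_nz regrq) (@subIsetl _ _ _) regpq)
    (affine_regular_inv regrq)) => w [Uw rw].
  by rewrite -fW ?mulfK //; apply: rW.
by move=> w [Uw /rW].
Qed.

End PolynomialFunctions.

Arguments polymap_lsubmx {C n m}.
Arguments polymap_rsubmx {C n m}.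
Arguments affine_openT {C n}.

(** * Orbits and invariant fractions *)

Section Irreducible.
Variable C : numFieldType.

Lemma poly_nonroot (p : {poly C}) : p != 0 -> exists t, p.[t] != 0.
Proof.
move=> nz_p; pose rs : seq C := [seq i%:R | i <- iota 0 (size p)].
have [/hasP[t _ pt]|/hasPn all_roots] := boolP (has (fun t => ~~ root p t) rs).
  by exists t.
have : (size rs < size p)%N.
  apply: max_poly_roots => //; first by apply/allP => t /all_roots/negPn.
  by rewrite map_inj_uniq ?iota_uniq //; apply: mulrIn; apply: oner_neq0.
by rewrite size_map size_iota ltnn.
Qed.

(** Two nonempty open sets meet already on the line through a point of each. *)
Lemma affine_irreducible n (U W : set 'rV[C]_n) :
  affine_open U -> affine_open W -> U !=set0 -> W !=set0 -> (U `&` W) !=set0.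
Proof.
move=> /affine_openP oU /affine_openP oW [v /oU[p [Pp pv pU]]].
move=> [w /oW[q [Pq qw qW]]].
pose l i : {poly C} := (v 0 i)%:P + (w 0 i - v 0 i) *: 'X.
have [f fE] := polyfun_curve l Pp; have [g gE] := polyfun_curve l Pq.
have l0 : \row_i (l i).[0] = v.
  by apply/rowP => i; rewrite mxE hornerD hornerC hornerZ hornerX mulr0 addr0.
have l1 : \row_i (l i).[1] = w.
  by apply/rowP => i; rewrite mxE hornerD hornerC hornerZ hornerX mulr1 addrC subrK.
have [t] : exists t, (f * g).[t] != 0.
  apply: poly_nonroot; apply/eqP => /eqP; rewrite mulf_eq0 => /orP[]/eqP h0.
    by move: pv; rewrite -l0 fE h0 horner0 eqxx.
  by move: qw; rewrite -l1 gE h0 horner0 eqxx.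
rewrite hornerM mulf_eq0 negb_or -fE -gE => /andP[/pU Ut /qW Wt].
by exists (\row_i (l i).[t]).
Qed.

End Irreducible.

Section Invariants.
Variables (C : numFieldType) (gT : finGroupType) (G : {group gT}) (n : nat).
Variable rG : mx_representation C G n.

Definition stable_set (U : set 'rV[C]_n) : Prop :=
  forall v g, g \in G -> U v -> U (v *m rG g).

Definition invariant_on (U : set 'rV[C]_n) (f : 'rV[C]_n -> C) : Prop :=
  forall v g, g \in G -> U v -> f (v *m rG g) = f v.

Definition orbit_sum (f : 'rV[C]_n -> C) v := \sum_(g in G) f (v *m rG g).

Lemma polyfun_orbit_sum f : polyfun f -> polyfun (orbit_sum f).
Proof.
move=> Pf; apply: (@polyfun_sum _ _ _ _ _ (fun g v => f (v *m rG g))) => g.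
exact: polyfun_comp (polymap_mulmx _) Pf.
Qed.

Lemma orbit_sum_inv f : invariant_on setT (orbit_sum f).
Proof.
move=> v g Gg _; rewrite /orbit_sum [RHS](reindex_inj (mulgI g)).
apply: eq_big => [h|h Gh]; first by rewrite groupMl.
by rewrite repr_mxM // mulmxA.
Qed.

Lemma stable_setV (U : set 'rV[C]_n) v g :
  stable_set U -> g \in G -> U (v *m rG g) -> U v.
Proof.
move=> stU Gg Uvg; rewrite -(repr_mxK rG Gg v).
by apply: stU; rewrite ?groupV.
Qed.

(** Averaging numerator and denominator of a fraction [f = p / q] over the group
keeps the identity [f q = p], but may kill the denominator at [v].  Multiplying
both by a polynomial [a] that vanishes on the rest of the orbit of [v] prevents
this: only the stabilizer of [v] contributes to the sum at [v]. *)
Lemma invariant_fraction (U : set 'rV[C]_n) f v :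
  stable_set U -> invariant_on U f -> affine_regular U f -> U v ->
  exists p q, [/\ polyfun p /\ polyfun q,
    invariant_on setT p /\ invariant_on setT q, q v != 0,
    forall w, q w != 0 -> U w & forall w, U w -> f w * q w = p w].
Proof.
move=> stU invf /affine_regularP regf Uv.
have [p [q [Pp Pq qv qU fU]]] := regf v Uv.
have [a [Pa av aE]] := polyfun_separate v [seq v *m rG g | g <- enum G].
exists (orbit_sum (fun w => a w * p w)), (orbit_sum (fun w => a w * q w)).
split=> [|||w|w Uw].
- by split; apply: polyfun_orbit_sum; apply: polyfun_mul.
- by split; apply: orbit_sum_inv.
- rewrite /orbit_sum (bigID [pred g | v *m rG g == v]) /= [X in _ + X]big1.
    rewrite addr0 (eq_bigr (fun=> a v * q v)) => [|g /andP[_ /eqP->] //].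
    rewrite sumr_const -mulr_natr !mulf_neq0 // pnatr_eq0 -lt0n.
    apply/card_gt0P; exists 1%g.
    by rewrite unfold_in /= group1 repr_mx1 mulmx1 eqxx.
  move=> g /andP[Gg neq]; rewrite aE ?mul0r //.
  by apply: map_f; rewrite mem_enum.
- apply: contra_neqP => nUw; apply: big1 => g Gg; apply/eqP; apply/negPn/negP.
  rewrite mulf_eq0 negb_or => /andP[_ /qU Uwg].
  exact/nUw/(stable_setV stU Gg).
rewrite mulr_sumr; apply: eq_bigr => g Gg.
by rewrite -(invf w g) // mulrCA fU //; apply: stU.
Qed.

Lemma invariant_open (U : set 'rV[C]_n) v :
  stable_set U -> affine_open U -> U v ->
  exists q, [/\ polyfun q, invariant_on setT q, q v != 0 &
    forall w, q w != 0 -> U w].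
Proof.
move=> stU oU Uv.
have reg1 := affine_regular_polyfun oU (@polyfun_cst C n 1).
have inv1 : invariant_on U (fun=> 1) by [].
have [_ [q [[_ Pq] [_ qinv] qv qU _]]] := invariant_fraction stU inv1 reg1 Uv.
by exists q.
Qed.

End Invariants.

Section QuotientPoints.
Variables (C : fieldType) (X : fspace C).
Variables (D : set (point X)) (r : point X -> point X -> Prop).
Hypothesis r_refl : forall x, r x x.
Hypothesis r_sym : forall x y, r x y -> r y x.
Hypothesis r_trans : forall x y z, r x y -> r y z -> r x z.

Lemma quo_class_subproof x : D x ->
  exists2 x', D x' & [set y | D y /\ r x y] = [set y | D y /\ r x' y].
Proof. by move=> Dx; exists x. Qed.

Definition quo_class x (Dx : D x) : quo_point D r :=
  exist _ _ (quo_class_subproof Dx).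

Definition quo_elt (O : quo_point D r) : point X := projT1 (cid2 (svalP O)).

Lemma quo_eltP O : D (quo_elt O).
Proof. by rewrite /quo_elt; case: cid2. Qed.

Lemma quo_mem O y : sval O y <-> D y /\ r (quo_elt O) y.
Proof. by rewrite /quo_elt; case: cid2 => x Dx /= ->. Qed.

Lemma quo_point_eq (O O' : quo_point D r) : sval O = sval O' -> O = O'.
Proof.
case: O O' => [O HO] [O' HO'] /= eqO; subst O'.
by rewrite (Prop_irrelevance HO HO').
Qed.

Lemma quo_class_eq x y (Dx : D x) (Dy : D y) :
  r x y -> quo_class Dx = quo_class Dy.
Proof.
move=> rxy; apply/quo_point_eq/seteqP; split=> z /= [Dz rz]; split=> //.
  exact: r_trans (r_sym rxy) rz.
exact: r_trans rxy rz.
Qed.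

Lemma quo_class_inj x y (Dx : D x) (Dy : D y) :
  quo_class Dx = quo_class Dy -> r x y.
Proof.
move=> /(congr1 sval)/= eqxy.
have : [set y0 | D y0 /\ r y y0] y by split.
by rewrite -eqxy => -[].
Qed.

Lemma quo_eltK O : quo_class (quo_eltP O) = O.
Proof.
by apply/quo_point_eq/seteqP; split=> z /= => [H|/quo_mem//]; apply/quo_mem.
Qed.

Lemma quo_elt_class x (Dx : D x) : r (quo_elt (quo_class Dx)) x.
Proof. exact: quo_class_inj (quo_eltK (quo_class Dx)). Qed.

Lemma quo_preimageE (W : set (quo_point D r)) x (Dx : D x) :
  quo_preimage W x <-> W (quo_class Dx).
Proof.
split=> [[O WO]|Wx]; last by exists (quo_class Dx) => //=; split.
case/quo_mem => _ rOx; suff <- : O = quo_class Dx by [].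
by rewrite -[LHS]quo_eltK; apply: quo_class_eq.
Qed.

End QuotientPoints.

Section LinearQuotientPoints.
Variables (C : numFieldType) (gT : finGroupType) (G : {group gT}) (n : nat).
Variable rG : mx_representation C G n.
Let r (v w : 'rV[C]_n) := exists2 g, g \in G & w = v *m rG g.

Let r_refl v : r v v.
Proof. by exists 1%g; rewrite ?group1 // repr_mx1 mulmx1. Qed.

Let r_sym v w : r v w -> r w v.
Proof. by case=> g Gg ->; exists g^-1%g; rewrite ?groupV // repr_mxK. Qed.

Let r_trans u v w : r u v -> r v w -> r u w.
Proof.
case=> g Gg -> [h Gh ->]; exists (g * h)%g; rewrite ?groupM //.
by rewrite repr_mxM // mulmxA.
Qed.

Definition orb (v : 'rV[C]_n) : point (linear_quotient rG) :=
  @quo_class C (affine_space C n) setT r v I.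

Definition orb_repr (O : point (linear_quotient rG)) : 'rV[C]_n := quo_elt O.

Lemma orb_reprK : cancel orb_repr orb.
Proof.
move=> O; rewrite -[RHS]quo_eltK.
by rewrite (Prop_irrelevance (quo_eltP O) I).
Qed.

Lemma orbP v w : orb v = orb w <-> exists2 g, g \in G & w = v *m rG g.
Proof.
split=> [|rvw]; first exact: (@quo_class_inj _ (affine_space C n) _ r r_refl).
exact: (@quo_class_eq _ (affine_space C n) _ r r_sym r_trans).
Qed.

Lemma orb_mul v g : g \in G -> orb (v *m rG g) = orb v.
Proof. by move=> Gg; apply/esym/orbP; exists g. Qed.

Lemma orb_reprP v : exists2 g, g \in G & orb_repr (orb v) = v *m rG g.
Proof. by apply/orbP; rewrite orb_reprK. Qed.

Lemma quo_preimage_orb (W : set (point (linear_quotient rG))) :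
  quo_preimage W = [set v | W (orb v)].
Proof.
by apply/seteqP; split=> v; rewrite (@quo_preimageE _ (affine_space C n) _ r
  r_refl r_sym r_trans W v I).
Qed.

Lemma linear_quotient_open (W : set (point (linear_quotient rG))) :
  zopen W <-> affine_open [set v | W (orb v)].
Proof. by rewrite -quo_preimage_orb. Qed.

Lemma linear_quotient_regular (W : set (point (linear_quotient rG))) f :
  regular W f <-> affine_regular [set v | W (orb v)] (fun v => f (orb v)).
Proof.
have memE O v : sval O v <-> orb v = O.
  rewrite (@quo_mem _ (affine_space C n) _ r); split=> [[_ rOv]|<-].
    by rewrite -[RHS]orb_reprK; apply/esym/orbP.
  by split=> //; apply: (@quo_elt_class _ (affine_space C n) _ r r_refl v I).
rewrite -quo_preimage_orb; split=> [[F regF Ff]|regf].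
  apply: affine_regular_ext regF => v; rewrite quo_preimage_orb /= => Wv.
  by apply: Ff Wv _ _; apply/memE.
by exists (fun v => f (orb v)) => // O WO v /memE ->.
Qed.

Lemma stable_preimage (W : set (point (linear_quotient rG))) :
  stable_set rG [set v | W (orb v)].
Proof. by move=> v g Gg /=; rewrite orb_mul. Qed.

End LinearQuotientPoints.

Lemma linear_quotient_eq (C : fieldType) (gT1 gT2 : finGroupType)
    (G1 : {group gT1}) (G2 : {group gT2}) n
    (r1 : mx_representation C G1 n) (r2 : mx_representation C G2 n) :
  (forall v w : 'rV[C]_n, (exists2 g, g \in G1 & w = v *m r1 g) <->
                 (exists2 g, g \in G2 & w = v *m r2 g)) ->
  linear_quotient r1 = linear_quotient r2.
Proof.
move=> eq_orb; rewrite /linear_quotient; congr quotient_space.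
by apply: funext => v; apply: funext => w; apply/propext/eq_orb.
Qed.

(** * Birational maps between linear quotients *)

Section Birational.
Variable C : fieldType.
Implicit Types X Y Z : fspace C.

Lemma birational_sym X Y : birational X Y -> birational Y X.
Proof. by case=> U [V [phi [psi [? ? ? ? [? ?]]]]]; exists V, U, psi, phi. Qed.

(** The stability of open sets under intersection is included because spaces
with functions carry an arbitrary family of open sets. *)
Definition irreducible_space Y : Prop :=
  (forall U V : set (point Y), zopen U -> zopen V -> zopen (U `&` V)) /\
  (forall U V : set (point Y), zopen U -> zopen V -> U !=set0 -> V !=set0 ->
     (U `&` V) !=set0).

Lemma morphism_on_comp X Y Z (U : set (point X)) (V V' : set (point Y))
    (W : set (point Z)) (phi : point X -> point Y)
    (phi' : point Y -> point Z) (psi' : point Z -> point Y) :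
  zopen (V `&` V') -> morphism_on U V phi -> morphism_on V' W phi' ->
  (forall y, V' y -> psi' (phi' y) = y) ->
  morphism_on (U `&` phi @^-1` (V `&` V')) (W `&` psi' @^-1` (V `&` V'))
    (phi' \o phi).
Proof.
move=> oVV' [UV mphi] [V'W mphi'] psiK; split=> [x [Ux [Vx V'x]]|W0 oW0 W0W].
  by split; [apply: V'W | rewrite /preimage /= psiK].
have [oA regA] := mphi' W0 oW0 (fun z Wz => proj1 (W0W z Wz)).
have AV : V' `&` phi' @^-1` W0 `<=` V.
  by move=> y [V'y /W0W[_]]; rewrite /preimage /= psiK // => -[].
have [oB regB] := mphi _ oA AV.
have eqB : (U `&` phi @^-1` (V `&` V')) `&` (phi' \o phi) @^-1` W0 =
           U `&` phi @^-1` (V' `&` phi' @^-1` W0).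
  apply/seteqP; split=> x /=; first by case=> -[Ux [Vx V'x]] W0x.
  by case=> Ux [V'x W0x]; split=> //; split=> //; split=> //; apply: AV.
by rewrite eqB; split=> // f /regA/regB.
Qed.

(** The two maps are composed over the intersection of their open sets in the
middle space, which is nonempty by irreducibility. *)
Lemma birational_trans X Y Z : irreducible_space Y ->
  birational X Y -> birational Y Z -> birational X Z.
Proof.
case=> YI Yirr [U [V [phi [psi [[oU U0] [oV V0] mphi mpsi [phiK psiK]]]]]].
case=> [V' [W [phi' [psi' [[oV' V'0] [oW W0] mphi' mpsi' [phi'K psi'K]]]]]].
have oVV' := YI _ _ oV oV'.
have [y0 [Vy0 V'y0]] := Yirr _ _ oV oV' V0 V'0.
exists (U `&` phi @^-1` (V `&` V')), (W `&` psi' @^-1` (V `&` V')).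
exists (phi' \o phi), (psi \o psi'); split.
- split; first by have [] := proj2 mphi _ oVV' (@subIsetl _ _ _).
  exists (psi y0); split; first exact: (proj1 mpsi).
  by rewrite /preimage /= psiK.
- split; first by have [] := proj2 mpsi' _ oVV' (@subIsetr _ _ _).
  exists (phi' y0); split; first exact: (proj1 mphi').
  by rewrite /preimage /= phi'K.
- exact: morphism_on_comp.
- rewrite (setIC V V'); apply: morphism_on_comp => //.
  by rewrite setIC.
split=> [x [Ux [_ V'x]]|z [Wz [Vz _]]] /=; first by rewrite phi'K // phiK.
by rewrite psiK // psi'K.
Qed.

End Birational.

Section LinearQuotientBirational.
Variables (C : numFieldType) (gT : finGroupType) (G : {group gT}).

Lemma linear_quotient_irreducible n (rG : mx_representation C G n) :
  irreducible_space (linear_quotient rG).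
Proof.
split=> U V /linear_quotient_open oU /linear_quotient_open oV.
  by apply/linear_quotient_open; apply: affine_openI oU oV.
move=> [O UO] [O' VO']; have [||v [Uv Vv]] := affine_irreducible oU oV.
- by exists (orb_repr O); rewrite /= orb_reprK.
- by exists (orb_repr O'); rewrite /= orb_reprK.
by exists (orb rG v).
Qed.

(** The map [q] induces a bijection between the quotients of [D] and [E].  It is a
morphism because [q] is regular; its inverse is one because invariant regular
functions are locally fractions of invariant polynomials, which descend along
[q].  The section [s] of [q] is an arbitrary function, so that [q] may be a
ramified covering. *)
Lemma linear_quotient_birational n m
    (rV : mx_representation C G n) (rW : mx_representation C G m)
    (D : set 'rV[C]_n) (E : set 'rV[C]_m)
    (q : 'rV[C]_n -> 'rV[C]_m) (s : 'rV[C]_m -> 'rV[C]_n) :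
  affine_open D -> D !=set0 -> affine_open E ->
  stable_set rV D -> stable_set rW E ->
  (forall v, D v -> E (q v)) -> (forall w, E w -> D (s w) /\ q (s w) = w) ->
  (forall v v', D v -> D v' ->
     orb rV v = orb rV v' <-> orb rW (q v) = orb rW (q v')) ->
  regular_map D q ->
  (forall p, polyfun p -> invariant_on rV setT p ->
     exists2 p', polyfun p' & forall v, D v -> p' (q v) = p v) ->
  birational (linear_quotient rV) (linear_quotient rW).
Proof.
move=> oD [v0 Dv0] oE stD stE qE sD orb_q reg_q desc.
pose U : set (point (linear_quotient rV)) := [set O | D (orb_repr O)].
pose V : set (point (linear_quotient rW)) := [set O | E (orb_repr O)].
pose phi (O : point (linear_quotient rV)) := orb rW (q (orb_repr O)).
pose psi (O : point (linear_quotient rW)) := orb rV (s (orb_repr O)).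
have UE v : U (orb rV v) <-> D v.
  rewrite /U /=; have [g Gg ->] := orb_reprP rV v.
  by split=> [/(stable_setV stD Gg)|/stD]; last exact.
have VE w : V (orb rW w) <-> E w.
  rewrite /V /=; have [g Gg ->] := orb_reprP rW w.
  by split=> [/(stable_setV stE Gg)|/stE]; last exact.
have phiE v : D v -> phi (orb rV v) = orb rW (q v).
  by move=> Dv; apply/orb_q; rewrite ?orb_reprK //; apply/UE.
have psiE w : E w -> psi (orb rW w) = orb rV (s w).
  move=> Ew; have [Ds qs] := sD w Ew.
  have [Ds' qs'] : D (s (orb_repr (orb rW w))) /\
    q (s (orb_repr (orb rW w))) = orb_repr (orb rW w) by apply/sD/VE.
  by apply/orb_q; rewrite // qs' qs orb_reprK.
exists U, V, phi, psi; split.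
- split; last by exists (orb rV v0); apply/UE.
  apply/linear_quotient_open; suff -> : [set v | U (orb rV v)] = D by [].
  by apply/seteqP; split=> v /UE.
- split; last by exists (orb rW (q v0)); apply/VE/qE.
  apply/linear_quotient_open; suff -> : [set v | V (orb rW v)] = E by [].
  by apply/seteqP; split=> v /VE.
- split=> [O|W oW WV].
    by rewrite -(orb_reprK O) => /UE Dv; rewrite phiE //; apply/VE/qE.
  have preE : [set v | (U `&` phi @^-1` W) (orb rV v)] =
              D `&` [set v | [set w | W (orb rW w)] (q v)].
    apply/seteqP; split=> v /=; rewrite /preimage /=.
      by case=> /UE Dv; rewrite phiE.
    by case=> Dv Wv; split; [apply/UE | rewrite phiE].
  split.
    apply/linear_quotient_open; rewrite preE; apply: regular_map_open => //.
    exact/linear_quotient_open.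
  move=> f /linear_quotient_regular regf; apply/linear_quotient_regular.
  rewrite preE; apply: affine_regular_ext (regular_comp oD reg_q regf) => v [Dv _].
  by rewrite /= phiE.
- split=> [O|W oW WU].
    rewrite -(orb_reprK O) => /VE Ew; rewrite psiE //; apply/UE.
    by case: (sD _ Ew).
  have preE : [set w | (V `&` psi @^-1` W) (orb rW w)] =
              [set w | E w /\ W (orb rV (s w))].
    apply/seteqP; split=> w /=; rewrite /preimage /=.
      by case=> /VE Ew; rewrite psiE.
    by case=> Ew Ww; split; [apply/VE | rewrite psiE].
  have key f : affine_regular [set v | W (orb rV v)] (fun v => f (orb rV v)) ->
      affine_regular [set w | E w /\ W (orb rV (s w))] (fun w => f (orb rV (s w))).
    move=> regf; apply/affine_regularP => w [Ew Ww].
    have invf : invariant_on rV [set v | W (orb rV v)] (fun v => f (orb rV v)).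
      by move=> v g Gg _; rewrite orb_mul.
    have [p [r [[Pp Pr] [invp invr] rsw rsub fp]]] :=
      invariant_fraction (stable_preimage (W := W)) invf regf Ww.
    have [p' Pp' pE] := desc p Pp invp; have [r' Pr' rE] := desc r Pr invr.
    have /affine_openP/(_ w Ew)[h [Ph hw hE]] := oE.
    exists (fun w => p' w * h w), (fun w => r' w * h w); split.
    - exact: polyfun_mul.
    - exact: polyfun_mul.
    - have [Ds qs] := sD w Ew.
      by rewrite mulf_neq0 // -qs rE.
    - move=> u; rewrite mulf_eq0 negb_or => /andP[ru /hE Eu].
      have [Ds qs] := sD u Eu; split=> //; apply: rsub.
      by rewrite -rE // qs.
    move=> u [Eu Wu]; have [Ds qs] := sD u Eu.
    by rewrite mulrA -[in r' u]qs rE // fp // -[in p' u]qs pE.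
  split.
    apply/linear_quotient_open; rewrite preE.
    apply: (affine_regular_open (f := fun=> 1)).
    apply: (key (fun=> 1)); apply: affine_regular_polyfun (polyfun_cst _ _).
    exact/linear_quotient_open.
  move=> f /linear_quotient_regular regf; apply/linear_quotient_regular.
  rewrite preE; apply: affine_regular_ext (key f regf) => w [Ew _].
  by rewrite /= psiE.
split=> [O|O].
  rewrite -(orb_reprK O) => /UE Dv; rewrite phiE // psiE; last exact: qE.
  by have [Ds qs] := sD _ (qE _ Dv); apply/orb_q; rewrite ?qs.
rewrite -(orb_reprK O) => /VE Ew; have [Ds qs] := sD _ Ew.
by rewrite psiE // phiE // qs.
Qed.

End LinearQuotientBirational.

(** * Direct sums and the no-name lemma *)

Section Representations.
Variables (C : fieldType) (gT : finGroupType) (G : {group gT}).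

Section DirectSum.
Variables (n m : nat) (rV : mx_representation C G n) (rW : mx_representation C G m).

Definition dsum_mx g : 'M[C]_(n + m) := block_mx (rV g) 0 0 (rW g).

Lemma dsum_mx_repr : mx_repr G dsum_mx.
Proof.
split=> [|g h Gg Gh]; first by rewrite /dsum_mx !repr_mx1 -scalar_mx_block.
rewrite /dsum_mx !repr_mxM // mulmx_block.
by rewrite !mulmx0 !mul0mx !addr0 !add0r.
Qed.

Definition dsum_repr := MxRepresentation dsum_mx_repr.

Lemma dsum_reprE (z : 'rV[C]_(n + m)) g :
  z *m dsum_repr g = row_mx (lsubmx z *m rV g) (rsubmx z *m rW g).
Proof.
by rewrite -{1}[z]hsubmxK mul_row_block !mulmx0 addr0 add0r.
Qed.

Lemma lsubmx_dsum (z : 'rV[C]_(n + m)) g : lsubmx (z *m dsum_repr g) = lsubmx z *m rV g.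
Proof. by rewrite dsum_reprE row_mxKl. Qed.

Lemma rsubmx_dsum (z : 'rV[C]_(n + m)) g : rsubmx (z *m dsum_repr g) = rsubmx z *m rW g.
Proof. by rewrite dsum_reprE row_mxKr. Qed.

End DirectSum.

Lemma triv_mx_repr m : mx_repr G (fun=> 1%:M : 'M[C]_m).
Proof. by split=> // g h _ _; rewrite mulmx1. Qed.

Definition triv_repr m := MxRepresentation (triv_mx_repr m).

Lemma char_mx_repr chi (lin : linear_character G chi) :
  mx_repr G (fun g => (chi g)%:M : 'M[C]_1).
Proof.
case: lin => chi1 chiM; split=> [|g h Gg Gh]; first by rewrite chi1.
by rewrite chiM // scalar_mxM.
Qed.

Definition char_repr chi (lin : linear_character G chi) :=
  MxRepresentation (char_mx_repr lin).

End Representations.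

Arguments triv_repr {C gT} G m.

Section Isomorphisms.
Variables (C : numFieldType) (gT : finGroupType) (G : {group gT}).

Lemma linear_quotient_iso n m (rV : mx_representation C G n)
    (rW : mx_representation C G m) (q : 'rV[C]_n -> 'rV[C]_m) s :
  polymap q -> polymap s -> cancel q s -> cancel s q ->
  (forall v g, g \in G -> q (v *m rV g) = q v *m rW g) ->
  birational (linear_quotient rV) (linear_quotient rW).
Proof.
move=> Pq Ps qK sK qM.
apply: (@linear_quotient_birational _ _ _ _ _ _ _ setT setT q s) => //.
- exact: affine_openT.
- by exists 0.
- exact: affine_openT.
- move=> v v' _ _; split=> /orbP[g Gg].
    by move=> ->; apply/orbP; exists g; rewrite ?qM.
  by rewrite -qM // => /(can_inj qK) ->; apply/orbP; exists g.
- by apply: regular_map_polymap => //; apply: affine_openT.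
move=> p Pp _; exists (fun w => p (s w)); first exact: polyfun_comp.
by move=> v _; rewrite qK.
Qed.

Lemma dsum_swap n m l (rU : mx_representation C G n)
    (rV : mx_representation C G m) (rW : mx_representation C G l) :
  birational (linear_quotient (dsum_repr (dsum_repr rU rV) rW))
             (linear_quotient (dsum_repr (dsum_repr rU rW) rV)).
Proof.
have Psw a b c : polymap (fun z : 'rV[C]_(a + b + c) =>
    row_mx (row_mx (lsubmx (lsubmx z)) (rsubmx z)) (rsubmx (lsubmx z))).
  apply: polymap_row_mx; first apply: polymap_row_mx.
  - exact: polymap_comp polymap_lsubmx polymap_lsubmx.
  - exact: polymap_rsubmx.
  - exact: polymap_comp polymap_lsubmx polymap_rsubmx.
apply: linear_quotient_iso (Psw n m l) (Psw n l m) _ _ _ => [z|z|z g Gg].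
- by rewrite !(row_mxKl, row_mxKr) !hsubmxK.
- by rewrite !(row_mxKl, row_mxKr) !hsubmxK.
by rewrite !dsum_reprE !(row_mxKl, row_mxKr, dsum_reprE).
Qed.

Lemma dsum_comm n m l (rU : mx_representation C G n)
    (rV : mx_representation C G m) (rW : mx_representation C G l) :
  birational (linear_quotient (dsum_repr (dsum_repr rU rV) rW))
             (linear_quotient (dsum_repr (dsum_repr rV rU) rW)).
Proof.
have Psw a b c : polymap (fun z : 'rV[C]_(a + b + c) =>
    row_mx (row_mx (rsubmx (lsubmx z)) (lsubmx (lsubmx z))) (rsubmx z)).
  apply: polymap_row_mx; first apply: polymap_row_mx.
  - exact: polymap_comp polymap_lsubmx polymap_rsubmx.
  - exact: polymap_comp polymap_lsubmx polymap_lsubmx.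
  - exact: polymap_rsubmx.
apply: linear_quotient_iso (Psw n m l) (Psw m n l) _ _ _ => [z|z|z g Gg].
- by rewrite !(row_mxKl, row_mxKr) !hsubmxK.
- by rewrite !(row_mxKl, row_mxKr) !hsubmxK.
by rewrite !dsum_reprE !(row_mxKl, row_mxKr, dsum_reprE).
Qed.

Lemma dsum_triv n (rU : mx_representation C G n) m l :
  birational
    (linear_quotient (dsum_repr (dsum_repr rU (triv_repr G m)) (triv_repr G l)))
    (linear_quotient (dsum_repr rU (triv_repr G (m + l)))).
Proof.
have Pq : polymap (fun z : 'rV[C]_(n + m + l) =>
    row_mx (lsubmx (lsubmx z)) (row_mx (rsubmx (lsubmx z)) (rsubmx z))).
  apply: polymap_row_mx; last apply: polymap_row_mx.
  - exact: polymap_comp polymap_lsubmx polymap_lsubmx.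
  - exact: polymap_comp polymap_lsubmx polymap_rsubmx.
  - exact: polymap_rsubmx.
have Ps : polymap (fun z : 'rV[C]_(n + (m + l)) =>
    row_mx (row_mx (lsubmx z) (lsubmx (rsubmx z))) (rsubmx (rsubmx z))).
  apply: polymap_row_mx; first apply: polymap_row_mx.
  - exact: polymap_lsubmx.
  - exact: polymap_comp polymap_rsubmx polymap_lsubmx.
  - exact: polymap_comp polymap_rsubmx polymap_rsubmx.
apply: linear_quotient_iso Pq Ps _ _ _ => [z|z|z g Gg].
- by rewrite !(row_mxKl, row_mxKr) !hsubmxK.
- by rewrite !(row_mxKl, row_mxKr) !hsubmxK.
by rewrite !dsum_reprE !(row_mxKl, row_mxKr, dsum_reprE) !mulmx1.
Qed.

End Isomorphisms.

Section NoName.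
Variables (C : numFieldType) (gT : finGroupType) (G : {group gT}).
Variables (n m : nat) (rV : mx_representation C G n) (rW : mx_representation C G m).

(** The frame is [M v = sum_g p (v g^-1) rW g].  With [p] vanishing on the orbit of
[v0] except at [v0] itself, only the stabilizer of [v0] contributes to [M v0], and
it acts trivially on [W]; so [M v0] is a nonzero scalar matrix. *)
Lemma equivariant_frame (v0 : 'rV[C]_n) :
  (forall g, g \in G -> v0 *m rV g = v0 -> rW g = 1%:M) ->
  exists M : 'rV[C]_n -> 'M[C]_m,
    [/\ forall i j, polyfun (fun v => M v i j),
        forall v g, g \in G -> M (v *m rV g) = M v *m rW g &
        M v0 \in unitmx].
Proof.
move=> stab; have [p [Pp p0 pE]] := polyfun_separate v0 [seq v0 *m rV g | g <- enum G].
exists (fun v => \sum_(g in G) p (v *m rV g^-1%g) *: rW g); split=> [i j|v h Gh|].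
- apply: (@polyfun_ext _ _ (fun v =>
    \sum_(g in G) p (v *m rV g^-1%g) * rW g i j)) => [v|].
    by rewrite summxE; apply: eq_bigr => g _; rewrite mxE.
  apply: (@polyfun_sum _ _ _ _ _ (fun g v => p (v *m rV g^-1%g) * rW g i j)) => g.
  apply: polyfun_mul (polyfun_cst _ _).
  exact: polyfun_comp (polymap_mulmx _) Pp.
- rewrite mulmx_suml (reindex_inj (mulIg h)) /=.
  apply: eq_big => [g|g Gg]; first by rewrite groupMr.
  rewrite groupMr // in Gg; rewrite repr_mxM // -scalemxAl; congr (p _ *: _).
  by rewrite -mulmxA -repr_mxM ?groupV ?groupM // invMg mulKVg.
have fixV g : g \in G -> v0 *m rV g^-1%g = v0 -> rW g = 1%:M.
  by move=> Gg fix_g; apply: stab => //; rewrite -[in LHS]fix_g repr_mxKV.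
rewrite (bigID [pred g | v0 *m rV g^-1%g == v0]) /= [X in _ + X]big1 ?addr0.
  rewrite (eq_bigr (fun=> (p v0)%:M)) => [|g /andP[Gg /eqP fix_g]]; last first.
    by rewrite fix_g fixV // scale_scalar_mx mulr1.
  rewrite sumr_const -scaler_nat scale_scalar_mx unitmxE det_scalar unitfE.
  rewrite expf_neq0 // mulf_neq0 // pnatr_eq0 -lt0n.
  apply/card_gt0P; exists 1%g.
  by rewrite unfold_in /= group1 invg1 repr_mx1 mulmx1 eqxx.
move=> g /andP[Gg neq]; rewrite pE ?scale0r // -[g^-1%g]/(g^-1%g).
by apply: map_f; rewrite mem_enum groupV.
Qed.

(** The rows of the frame [M] form a moving basis of [W], and the coordinate change
[(v, w) |-> (v, w M(v)^-1)] turns the action on [W] into the trivial one. *)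
Lemma no_name (v0 : 'rV[C]_n) :
  (forall g, g \in G -> v0 *m rV g = v0 -> rW g = 1%:M) ->
  birational (linear_quotient (dsum_repr rV rW))
             (linear_quotient (dsum_repr rV (triv_repr G m))).
Proof.
case/equivariant_frame=> M [PM MG M0].
pose D := [set z : 'rV[C]_(n + m) | \det (M (lsubmx z)) != 0].
have DU z : D z <-> M (lsubmx z) \in unitmx by rewrite /D /= unitmxE unitfE.
pose q (z : 'rV[C]_(n + m)) := row_mx (lsubmx z) (rsubmx z *m invmx (M (lsubmx z))).
pose s (z : 'rV[C]_(n + m)) := row_mx (lsubmx z) (rsubmx z *m M (lsubmx z)).
have PMl i j : polyfun (fun z : 'rV[C]_(n + m) => M (lsubmx z) i j).
  exact: polyfun_comp polymap_lsubmx (PM i j).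
have oD : affine_open D by apply: affine_open_nz; apply: polyfun_det.
have Ps : polymap s.
  apply: polymap_row_mx polymap_lsubmx _ => j.
  apply: (@polyfun_ext _ _ (fun z => \sum_k rsubmx z 0 k * M (lsubmx z) k j)).
    by move=> z; rewrite mxE.
  apply: (@polyfun_sum _ _ _ _ _ (fun k z => rsubmx z 0 k * M (lsubmx z) k j)) => k.
  exact: polyfun_mul (polymap_rsubmx _) (PMl _ _).
have qK z : D z -> s (q z) = z.
  by move=> /DU Mu; rewrite /s /q row_mxKl row_mxKr mulmxKV // hsubmxK.
have stD1 v g : g \in G -> M v \in unitmx -> M (v *m rV g) \in unitmx.
  by move=> Gg Mv; rewrite MG // unitmx_mul Mv repr_mx_unit.
have qM z g : g \in G -> D z ->
    q (z *m dsum_repr rV rW g) = q z *m dsum_repr rV (triv_repr G m) g.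
  move=> Gg /DU Mz; rewrite /q !dsum_reprE !row_mxKl !row_mxKr MG // mulmx1.
  have Mu : M (lsubmx z) *m rW g \in unitmx by rewrite unitmx_mul Mz repr_mx_unit.
  congr row_mx; apply: (canLR (mulmxK Mu)).
  by rewrite mulmxA mulmxKV.
apply: (@linear_quotient_birational _ _ _ _ _ _ _ D D q s) => //.
- by exists (row_mx v0 0); apply/DU; rewrite row_mxKl.
- by move=> z g Gg /DU Mz; apply/DU; rewrite lsubmx_dsum stD1.
- by move=> z g Gg /DU Mz; apply/DU; rewrite lsubmx_dsum stD1.
- by move=> z /DU Mz; apply/DU; rewrite row_mxKl.
- move=> w /DU Mw; split; first by apply/DU; rewrite row_mxKl.
  by rewrite /q /s !row_mxKl row_mxKr mulmxK // hsubmxK.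
- move=> z z' Dz Dz'; split=> /orbP[g Gg].
    by move=> ->; apply/orbP; exists g; rewrite ?qM.
  rewrite -qM // => eq_q; apply/orbP; exists g => //.
  rewrite -(qK z') // eq_q qK //.
  by apply/DU; rewrite lsubmx_dsum stD1 //; apply/DU.
- apply: regular_map_row_mx => [|j].
    by apply: regular_map_polymap => //; apply: polymap_lsubmx.
  apply: (@affine_regular_ext _ _ _ (fun z => \sum_k rsubmx z 0 k *
      ((\det (M (lsubmx z)))^-1 * (\adj (M (lsubmx z))) k j))) => [z /DU Mz|].
    rewrite mxE; apply: eq_bigr => k _; rewrite /invmx Mz.
    by congr (_ * _); rewrite [RHS]mxE.
  apply: affine_regular_sum => // k.
  apply: affine_regular_mul; first exact: affine_regular_polyfun (polymap_rsubmx _).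
  apply: affine_regular_mul.
    have := affine_regular_inv
      (affine_regular_polyfun affine_openT (polyfun_det PMl)).
    by rewrite setTI.
  by apply: affine_regular_polyfun => //; apply: polyfun_adj.
move=> p Pp _; exists (fun w => p (s w)); first exact: polyfun_comp.
by move=> z Dz; rewrite qK.
Qed.

End NoName.

(** * Untwisting a linear character *)

Section SplitVariables.
Variable C : fieldType.

Lemma polyfun_split n m p : @polyfun C (n + m) p ->
  exists (I : finType) (f : I -> 'rV[C]_n -> C) (g : I -> 'rV[C]_m -> C),
    [/\ forall i, polyfun (f i), forall i, polyfun (g i) &
        forall z, p z = \sum_i f i (lsubmx z) * g i (rsubmx z)].
Proof.
elim=> [c|k|{}p q _ IHp _ IHq|{}p q _ IHp _ IHq].
- exists unit, (fun _ _ => c), (fun _ _ => 1).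
  split=> [_|_|z]; try exact: polyfun_cst.
  by rewrite big_const card_unit /= addr0 mulr1.
- rewrite -(splitK k); case: (fintype.split k) => i /=.
    exists unit, (fun _ v => v 0 i), (fun _ _ => 1).
    split=> [_|_|z]; [exact: polyfun_coord | exact: polyfun_cst |].
    by rewrite big_const card_unit /= addr0 mulr1 mxE.
  exists unit, (fun _ _ => 1), (fun _ v => v 0 i).
  split=> [_|_|z]; [exact: polyfun_cst | exact: polyfun_coord |].
  by rewrite big_const card_unit /= addr0 mul1r mxE.
- have [I [f [g [Pf Pg pE]]]] := IHp; have [J [f' [g' [Pf' Pg' qE]]]] := IHq.
  exists (I + J)%type, (fun k => match k with inl i => f i | inr j => f' j end),
    (fun k => match k with inl i => g i | inr j => g' j end).
  split=> [[]//|[]//|z]; by rewrite big_sumType /= pE qE.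
have [I [f [g [Pf Pg pE]]]] := IHp; have [J [f' [g' [Pf' Pg' qE]]]] := IHq.
exists (I * J)%type, (fun k v => f k.1 v * f' k.2 v), (fun k v => g k.1 v * g' k.2 v).
split=> [k|k|z]; try exact: polyfun_mul.
rewrite pE qE big_distrlr pair_big /=; apply: eq_bigr => k _.
by rewrite mulrACA.
Qed.

Lemma polyfun_horner n (h : {poly C}) (f : 'rV[C]_n -> C) :
  polyfun f -> polyfun (fun v => h.[f v]).
Proof.
move=> Pf; apply: (@polyfun_ext _ _ (fun v => \sum_(i < size h) h`_i * f v ^+ i)).
  by move=> v; rewrite horner_coef.
apply: (@polyfun_sum _ _ _ _ _ (fun (i : 'I_(size h)) v => h`_i * f v ^+ i)) => i.
exact: polyfun_mul (polyfun_cst _ _) (polyfun_exp _ Pf).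
Qed.

(** The sum of the [k]-th powers of the [d]-th roots of unity vanishes unless [d]
divides [k], so that averaging keeps exactly the monomials in [t ^ d]. *)
Lemma average_unity_root (p : {poly C}) d (z : C) : d.-primitive_root z ->
  exists h : {poly C}, forall t, \sum_(j < d) p.[z ^+ j * t] = h.[t ^+ d].
Proof.
move=> prim_z; pose S k := \sum_(j < d) (z ^+ k) ^+ j.
have S0 k : ~~ (d %| k)%N -> S k = 0.
  move=> ndk; have /eqP := subrX1 (z ^+ k) d.
  rewrite -exprM mulnC exprM (prim_expr_order prim_z) expr1n subrr eq_sym mulf_eq0.
  by rewrite subr_eq0 -(prim_order_dvd prim_z) (negPf ndk) => /eqP.
exists (\sum_(k < size p) (p`_k * S k) *: 'X^(k %/ d)) => t.
transitivity (\sum_(k < size p) p`_k * t ^+ k * S k).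
  under eq_bigr do rewrite horner_coef.
  rewrite exchange_big; apply: eq_bigr => k _ /=.
  rewrite mulr_sumr; apply: eq_bigr => j _.
  by rewrite exprMn -mulrA [t ^+ _ * _]mulrC -!exprM [(k * j)%N]mulnC.
rewrite horner_sum; apply: eq_bigr => k _ /=.
rewrite hornerZ hornerXn -exprM mulnC.
have [dk|/S0 Sk0] := boolP (d %| k)%N; last by rewrite Sk0 !mulr0 mul0r.
by rewrite divnK // mulrAC.
Qed.

End SplitVariables.

Section CharacterExtension.
Variables (C : numClosedFieldType) (gT : finGroupType) (G : {group gT}).
Variables (n : nat) (rV : mx_representation C G n) (v0 : 'rV[C]_n).
Variables (chi : gT -> C) (lin : linear_character G chi).

Hypothesis effective : forall g, g \in G -> v0 *m rV g = v0 -> rV g = 1%:M.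

(** A finite subgroup of the multiplicative group of a field, here the image of the
kernel of [rV] under [chi], consists of all [d]-th roots of unity, with [d] its
order. *)
Lemma kernel_values : exists d (z : C), [/\ (0 < d)%N, d.-primitive_root z,
  forall g, g \in G -> rV g = 1%:M -> chi g ^+ d = 1 &
  forall c, c ^+ d = 1 -> exists2 g, g \in G /\ rV g = 1%:M & chi g = c].
Proof.
have [chi1 chiM] := lin.
pose T := undup [seq chi g | g <- enum G & rV g == 1%:M].
have memT c : c \in T <-> exists2 g, g \in G /\ rV g = 1%:M & chi g = c.
  rewrite mem_undup; split=> [/mapP[g]|[g [Gg rg1] <-]].
    by rewrite mem_filter mem_enum => /andP[/eqP rg1 Gg] ->; exists g.
  by apply: map_f; rewrite mem_filter mem_enum Gg rg1 eqxx.
have T1 : 1 \in T by apply/memT; exists 1%g; rewrite ?group1 ?repr_mx1.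
have d_gt0 : (0 < size T)%N by case: (T) T1.
have Tnz c : c \in T -> c != 0.
  by case/memT=> g [Gg _] <-; apply: (linear_character_neq0 lin).
have unitT c : c \in T -> c ^+ size T = 1.
  (* Multiplication by c permutes T, so the product of T equals c ^ #T times
     itself. *)
  move=> Tc; have permT : perm_eq [seq c * x | x <- T] T.
    have uniqT := undup_uniq [seq chi g | g <- enum G & rV g == 1%:M].
    have uniqcT : uniq [seq c * x | x <- T].
      by rewrite map_inj_uniq //; apply: mulfI; apply: Tnz.
    have subT : {subset [seq c * x | x <- T] <= T}.
      move=> _ /mapP[x Tx ->]; apply/memT.
      have /memT[g [Gg rg] <-] := Tc; have /memT[h [Gh rh] <-] := Tx.
      exists (g * h)%g; last by rewrite chiM.
      by rewrite groupM // repr_mxM // rg rh mulmx1.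
    have [|_ eqT] := uniq_min_size uniqcT subT; first by rewrite size_map.
    exact: uniq_perm.
  have nzT : \prod_(x <- T) x != 0.
    by rewrite prodf_seq_neq0; apply/allP => x /Tnz.
  apply: (mulIf nzT); rewrite mul1r -[in RHS](perm_big _ permT) /= big_map.
  rewrite big_split /= big_const_seq count_predT.
  by rewrite (iter_mulr_1 (size T) c).
have all_unity : all (size T).-unity_root T.
  by apply/allP => c /unitT c1; rewrite unity_rootE c1.
have uniqT : uniq T by apply: undup_uniq.
have /hasP[z Tz prim_z] := has_prim_root d_gt0 all_unity uniqT (leqnn _).
exists (size T), z; split=> // [g Gg rg1|c c1].
  by apply/unitT/memT; exists g.
apply/memT; rewrite -(mem_unity_roots d_gt0 all_unity uniqT erefl).
by apply/unity_rootP.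
Qed.

(** Since [chi ^ d] is trivial on the kernel of [rV], there is a polynomial [m] on
[V] with [m (v g) = m v * chi g ^ d] that is nonzero at [v0].  The map
[(v, x) |-> (v, x ^ d / m v)] is invariant in its last coordinate.  Two values of
[x] with the same [d]-th power differ by a [d]-th root of unity, that is by the
action of the kernel, which fixes [v]; so orbits match.  For the same reason an
invariant polynomial involves [x] only through [x ^ d]. *)
Lemma character_untwist :
  birational (linear_quotient (dsum_repr rV (char_repr lin)))
             (linear_quotient (dsum_repr rV (triv_repr G 1))).
Proof.
have [d [z [d_gt0 prim_z chi_d chi_onto]]] := kernel_values.
have [M [PM MG M0]] : exists M : 'rV[C]_n -> 'M[C]_1,
    [/\ forall i j, polyfun (fun v => M v i j),
        forall v g, g \in G ->
          M (v *m rV g) = M v *m char_repr (linear_character_exp d lin) g &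
        M v0 \in unitmx].
  apply: equivariant_frame => g Gg /(effective Gg) rg1.
  by rewrite /= chi_d.
pose m v := M v 0 0.
have Pm : polyfun m by apply: PM.
have mG v g : g \in G -> m (v *m rV g) = m v * chi g ^+ d.
  by move=> Gg; rewrite /m MG // /= mul_mx_scalar mxE mulrC.
have m0 : m v0 != 0.
  by move: M0; rewrite unitmxE unitfE [M v0]mx11_scalar det_scalar expr1.
have chi0 := linear_character_neq0 lin.
pose D := [set w : 'rV[C]_(n + 1) | m (lsubmx w) != 0].
pose x (w : 'rV[C]_(n + 1)) := rsubmx w 0 0.
pose q w : 'rV[C]_(n + 1) := row_mx (lsubmx w) (x w ^+ d / m (lsubmx w))%:M.
pose s w : 'rV[C]_(n + 1) := row_mx (lsubmx w) (d.-root (x w * m (lsubmx w)))%:M.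
have Pml : polyfun (fun w : 'rV[C]_(n + 1) => m (lsubmx w)).
  exact: polyfun_comp polymap_lsubmx Pm.
have Px : polyfun x by apply: polymap_rsubmx.
have oD : affine_open D by apply: affine_open_nz.
have eq_split (w w' : 'rV[C]_(n + 1)) : lsubmx w = lsubmx w' -> x w = x w' -> w = w'.
  move=> eql eqx; rewrite -[w]hsubmxK -[w']hsubmxK eql; congr row_mx.
  by rewrite [LHS]mx11_scalar [RHS]mx11_scalar -/(x w) eqx.
have xK (v : 'rV[C]_n) (c : C) : x (row_mx v c%:M) = c.
  by rewrite /x row_mxKr mxE eqxx.
have xchi w g : x (w *m dsum_repr rV (char_repr lin) g) = x w * chi g.
  by rewrite /x rsubmx_dsum /= mul_mx_scalar mxE mulrC.
have xtriv w g : x (w *m dsum_repr rV (triv_repr G 1) g) = x w.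
  by rewrite /x rsubmx_dsum /= mulmx1.
have stD (rW : mx_representation C G 1) : stable_set (dsum_repr rV rW) D.
  by move=> w g Gg Dw; rewrite /D /= lsubmx_dsum mG // mulf_neq0 // expf_neq0 // chi0.
have qM w g : g \in G ->
    q (w *m dsum_repr rV (char_repr lin) g) = q w *m dsum_repr rV (triv_repr G 1) g.
  move=> Gg; apply: eq_split; first by rewrite lsubmx_dsum !row_mxKl lsubmx_dsum.
  rewrite xtriv !xK xchi lsubmx_dsum mG // exprMn -mulf_div divff ?mulr1 //.
  by rewrite expf_neq0 // chi0.
apply: (@linear_quotient_birational _ _ _ _ _ _ _ D D q s) => //.
- by exists (row_mx v0 0); rewrite /D /= row_mxKl.
- by move=> w Dw; rewrite /D /= row_mxKl.
- move=> w Dw; split; first by rewrite /D /= row_mxKl.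
  apply: eq_split; first by rewrite !row_mxKl.
  by rewrite xK /s row_mxKl xK rootCK // mulfK.
- move=> w w' Dw Dw'; split=> /orbP[g Gg].
    by move=> ->; apply/orbP; exists g; rewrite ?qM.
  rewrite -qM // => eq_q; apply/orbP.
  have eq_l : lsubmx w' = lsubmx w *m rV g.
    by have := congr1 lsubmx eq_q; rewrite !row_mxKl lsubmx_dsum.
  have eq_x : x w' ^+ d = (x w * chi g) ^+ d.
    have := congr1 x eq_q; rewrite !xK xchi lsubmx_dsum -eq_l.
    by apply: mulIf; rewrite invr_eq0.
  (* The element g already matches the first components; it is corrected by an
     element of the kernel to match the second ones. *)
  have [xw0|nz_xw] := eqVneq (x w) 0.
    exists g => //; apply: eq_split; first by rewrite lsubmx_dsum.
    rewrite xchi xw0 mul0r; move/eqP: eq_x.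
    by rewrite xw0 mul0r expr0n -(prednK d_gt0) expf_eq0 /= => /eqP.
  have nz : x w * chi g != 0 by rewrite mulf_neq0 // chi0.
  have [|h [Gh rh1] chi_h] := chi_onto (x w' / (x w * chi g)).
    by rewrite expr_div_n eq_x divff // expf_neq0.
  exists (g * h)%g; rewrite ?groupM //.
  apply: eq_split; first by rewrite lsubmx_dsum repr_mxM // rh1 mulmx1.
  by rewrite xchi (proj2 lin) // chi_h mulrA mulrC divfK.
- apply: regular_map_row_mx => [|j].
    exact: regular_map_polymap oD polymap_lsubmx.
  apply: (@affine_regular_ext _ _ _ (fun w => x w ^+ d * (m (lsubmx w))^-1)).
    by move=> w _; rewrite ord1 mxE eqxx mulr1n.
  apply: affine_regular_mul; first exact: affine_regular_polyfun (polyfun_exp _ Px).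
  have := affine_regular_inv (affine_regular_polyfun affine_openT Pml).
  by rewrite setTI.
move=> p Pp invp; have [J [f [g [Pf Pg pE]]]] := polyfun_split Pp.
(* Averaging over the roots of unity leaves p unchanged and replaces each g i by
   a polynomial in x ^ d. *)
have /choice[h hE] : forall i, exists h : {poly C}, forall t,
    \sum_(j < d) g i (z ^+ j * t)%:M = h.[t ^+ d].
  move=> i; have [pg pgE] := polyfun_curve (fun=> 'X) (Pg i).
  have [h hE] := average_unity_root pg prim_z; exists h => t.
  rewrite -hE; apply: eq_bigr => j _; rewrite -pgE; congr (g i _).
  by apply/rowP => k; rewrite !mxE hornerX ord1 eqxx mulr1n.
exists (fun w => d%:R^-1 * \sum_i f i (lsubmx w) * (h i).[x w * m (lsubmx w)]).
  apply: polyfun_mul (polyfun_cst _ _) _.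
  apply: (@polyfun_sum _ _ _ _ _
    (fun i w => f i (lsubmx w) * (h i).[x w * m (lsubmx w)])) => i.
  apply: polyfun_mul; first exact: polyfun_comp polymap_lsubmx (Pf i).
  exact/polyfun_horner/polyfun_mul.
move=> w Dw; rewrite row_mxKl xK divfK //.
have nz_d : (d%:R : C) != 0 by rewrite pnatr_eq0 -lt0n.
apply: (mulfI nz_d); rewrite mulrA mulfV // mul1r.
under eq_bigr do rewrite -hE mulr_sumr.
rewrite exchange_big /= mulr_natl -[in RHS](card_ord d) -sumr_const.
apply: eq_bigr => j _.
have [|k [Gk rk1] chi_k] := chi_onto (z ^+ j).
  by rewrite -exprM mulnC exprM (prim_expr_order prim_z) expr1n.
rewrite -(invp w k Gk I) pE; apply: eq_bigr => i _.
rewrite lsubmx_dsum rk1 mulmx1; congr (_ * g i _).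
by rewrite [RHS]mx11_scalar -/(x _) xchi chi_k mulrC.
Qed.

End CharacterExtension.

(** * Stable equivalence of representations *)

Section StableEquivalence.
Variables (C : numClosedFieldType) (gT : finGroupType) (G : {group gT}).

Definition triv_quotient n (rV : mx_representation C G n) k : fspace C :=
  linear_quotient (dsum_repr rV (triv_repr G k)).

(** Birationality of the quotients after adding trivial representations.  The
quantifier over [k] makes the relation transitive: adding more trivial summands
to a given birational map would otherwise require taking products of maps. *)
Definition stably_equiv n m (rV : mx_representation C G n)
    (rW : mx_representation C G m) : Prop :=
  exists i j, forall k,
    birational (triv_quotient rV (i + k)) (triv_quotient rW (j + k)).

Lemma stably_equiv_sym n m (rV : mx_representation C G n)
    (rW : mx_representation C G m) : stably_equiv rV rW -> stably_equiv rW rV.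
Proof. by case=> i [j eqVW]; exists j, i => k; apply/birational_sym/eqVW. Qed.

Lemma stably_equiv_trans n m l (rU : mx_representation C G n)
    (rV : mx_representation C G m) (rW : mx_representation C G l) :
  stably_equiv rU rV -> stably_equiv rV rW -> stably_equiv rU rW.
Proof.
case=> i [j eqUV] [i' [j' eqVW]]; exists (i + i')%N, (j' + j)%N => k.
have eqUVk := eqUV (i' + k)%N; have eqVWk := eqVW (j + k)%N.
rewrite (addnA i) in eqUVk; rewrite (addnCA i') (addnA j') in eqVWk.
exact: birational_trans (linear_quotient_irreducible _) eqUVk eqVWk.
Qed.

Lemma stably_equiv_refl n (rV : mx_representation C G n) : stably_equiv rV rV.
Proof.
exists 0%N, 0%N => k.
exact: (linear_quotient_iso (@polymap_id C _) (@polymap_id C _)).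
Qed.

Lemma stably_equiv_comm n m (rV : mx_representation C G n)
    (rW : mx_representation C G m) :
  stably_equiv (dsum_repr rV rW) (dsum_repr rW rV).
Proof. by exists 0%N, 0%N => k; apply: dsum_comm. Qed.

Lemma stably_equiv_dsum n m (rV : mx_representation C G n)
    (rW : mx_representation C G m) :
  (forall k, let rVk := dsum_repr rV (triv_repr G k) in
     birational (linear_quotient (dsum_repr rVk rW))
                (linear_quotient (dsum_repr rVk (triv_repr G m)))) ->
  stably_equiv rV (dsum_repr rV rW).
Proof.
move=> untwist; apply: stably_equiv_sym; exists 0%N, m => k.
apply: (birational_trans (linear_quotient_irreducible _) (dsum_swap _ _ _)).
apply: (birational_trans (linear_quotient_irreducible _) (untwist k)).
by rewrite (addnC m k); apply: dsum_triv.
Qed.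

Definition free_at n (rV : mx_representation C G n) (v : 'rV[C]_n) : Prop :=
  forall g, g \in G -> v *m rV g = v -> g = 1%g.

(** The stabilizer of [v] is as small as possible, namely the kernel of the
representation. *)
Definition effective_at n (rV : mx_representation C G n) (v : 'rV[C]_n) : Prop :=
  forall g, g \in G -> v *m rV g = v -> rV g = 1%:M.

(** Both quotients are compared with the quotient of the direct sum, by the no-name
lemma applied over either summand. *)
Lemma stably_equiv_free n m (rV : mx_representation C G n)
    (rW : mx_representation C G m) v w :
  free_at rV v -> free_at rW w -> stably_equiv rV rW.
Proof.
have half a b (rA : mx_representation C G a) (rB : mx_representation C G b) u :
    free_at rA u -> stably_equiv rA (dsum_repr rA rB).
  move=> freeA; apply: stably_equiv_dsum => k.
  apply: (@no_name _ _ _ _ _ _ _ (row_mx u 0)) => g Gg.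
  rewrite dsum_reprE row_mxKl => /(congr1 lsubmx); rewrite !row_mxKl.
  by move/(freeA g Gg)->; rewrite repr_mx1.
move=> freeV freeW; apply: stably_equiv_trans (half _ _ _ rW _ freeV) _.
apply: stably_equiv_trans (stably_equiv_comm _ _) _.
exact/stably_equiv_sym/(half _ _ _ _ _ freeW).
Qed.

Lemma stably_equiv_char n (rV : mx_representation C G n) v chi
    (lin : linear_character G chi) :
  effective_at rV v -> stably_equiv rV (dsum_repr rV (char_repr lin)).
Proof.
move=> effV; apply: stably_equiv_dsum => k.
apply: (@character_untwist _ _ _ _ _ (row_mx v 0)) => g Gg.
rewrite dsum_reprE row_mxKl => /(congr1 lsubmx); rewrite !row_mxKl.
move/(effV g Gg) => rg1; rewrite /= /dsum_mx rg1.
by rewrite -scalar_mx_block.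
Qed.

(** Adding a character, with coordinate 1 at the base point, intersects both the
stabilizer of the base point and the kernel of the representation with the kernel
of the character; so they still agree and the next one can be added. *)
Lemma adjoin_characters n (rV : mx_representation C G n) v (cs : seq (gT -> C)) :
  effective_at rV v ->
  (forall k, (k < size cs)%N -> linear_character G (nth (fun=> 1) cs k)) ->
  exists m (rW : mx_representation C G m) w,
    [/\ stably_equiv rV rW, effective_at rW w &
        forall g, g \in G -> rW g = 1%:M -> rV g = 1%:M /\
          forall k, (k < size cs)%N -> nth (fun=> 1) cs k g = 1].
Proof.
elim: cs => [|chi cs IHcs] in n rV v * => effV lin.
  by exists n, rV, v; split=> //; apply: stably_equiv_refl.
have linchi := lin 0%N isT; rewrite /= in linchi.
have effVchi : effective_at (dsum_repr rV (char_repr linchi)) (row_mx v (const_mx 1)).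
  move=> g Gg; rewrite dsum_reprE row_mxKl row_mxKr => fix_g.
  have /(effV g Gg) rg1 : v *m rV g = v.
    by have := congr1 lsubmx fix_g; rewrite !row_mxKl.
  have : (const_mx 1 : 'rV[C]_1) *m (chi g)%:M = const_mx 1.
    by have := congr1 rsubmx fix_g; rewrite !row_mxKr.
  rewrite mul_mx_scalar => /matrixP/(_ 0 0); rewrite !mxE mulr1 => chi1.
  by rewrite /= /dsum_mx rg1 /= chi1 -scalar_mx_block.
have [|m [rW [w [eqW effW kerW]]]] := IHcs _ _ _ effVchi.
  by move=> k; apply: (lin k.+1).
exists m, rW, w; split=> // [|g Gg /(kerW g Gg)[]].
  exact: stably_equiv_trans (stably_equiv_char linchi effV) eqW.
rewrite /= /dsum_mx scalar_mx_block => /eq_block_mx[rg1 _ _ /matrixP/(_ 0 0)].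
by rewrite !mxE !mulr1n => chig1 cs1; split=> // -[].
Qed.

End StableEquivalence.

(** * Products with projective space *)

Section ProjectiveChart.
Variables (C : numFieldType) (a : nat).

Let nonzero : set (point (affine_space C a.+1)) := [set v : 'rV[C]_a.+1 | v <> 0].
Let scal (v w : 'rV[C]_a.+1) := exists2 c : C, c != 0 & w = c *: v.

Let scal_refl v : scal v v.
Proof. by exists 1; rewrite ?oner_neq0 // scale1r. Qed.

Let scal_sym v w : scal v w -> scal w v.
Proof.
case=> c nzc ->; exists c^-1; first by rewrite invr_neq0.
by rewrite scalerA mulVf // scale1r.
Qed.

Let scal_trans u v w : scal u v -> scal v w -> scal u w.
Proof.
case=> c nzc -> [d nzd ->]; exists (d * c); first exact: mulf_neq0.
by rewrite scalerA.
Qed.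

Definition homogenize (u : 'rV[C]_a) : 'rV[C]_a.+1 := row_mx (1%:M : 'M[C]_1) u.

Definition dehomogenize (l : 'rV[C]_a.+1) : 'rV[C]_a :=
  (l 0 0)^-1 *: rsubmx (l : 'rV[C]_(1 + a)).

Lemma homogenize0 u : homogenize u 0 0 = 1.
Proof.
have -> : (0 : 'I_a.+1) = lshift a (0 : 'I_1) by apply: val_inj.
by apply: etrans (@row_mxEl _ 1 1 a _ _ _ _) _; rewrite mxE eqxx.
Qed.

Lemma homogenize_neq0 u : nonzero (homogenize u).
Proof.
move=> /(congr1 (fun l : 'rV[C]_a.+1 => l 0 0)).
by rewrite homogenize0 mxE => /eqP; rewrite oner_eq0.
Qed.

Definition proj_point (u : 'rV[C]_a) : point (projective_space C a) :=
  @quo_class C (affine_space C a.+1) nonzero scal _ (@homogenize_neq0 u).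

Definition proj_repr (L : point (projective_space C a)) : 'rV[C]_a.+1 := quo_elt L.

Definition proj_coord L : 'rV[C]_a := dehomogenize (proj_repr L).

Definition chart : set (point (projective_space C a)) :=
  [set L | proj_repr L 0 0 != 0].

Lemma dehomogenize_scale c l : c != 0 -> dehomogenize (c *: l) = dehomogenize l.
Proof.
move=> nzc; rewrite /dehomogenize mxE linearZ /= scalerA invfM mulrAC mulVf //.
by rewrite mul1r.
Qed.

Lemma homogenizeK : cancel homogenize dehomogenize.
Proof.
by move=> u; rewrite /dehomogenize homogenize0 invr1 scale1r row_mxKr.
Qed.

Lemma dehomogenizeK (l : 'rV[C]_a.+1) : l 0 0 != 0 ->
  l = l 0 0 *: homogenize (dehomogenize l).
Proof.
move=> nzl; pose l' : 'rV[C]_(1 + a) := l.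
have -> : l 0 0 *: homogenize (dehomogenize l) =
    row_mx (l 0 0)%:M (l 0 0 *: dehomogenize l) :> 'rV[C]_(1 + a).
  apply: etrans (@scale_row_mx _ 1 1 a _ _ _) _.
  by rewrite scale_scalar_mx mulr1.
apply: etrans (esym (@hsubmxK _ 1 1 a l')) _; apply: (f_equal2 (@row_mx C 1 1 a)).
  by rewrite [LHS]mx11_scalar mxE; congr (l _ _)%:M; apply: val_inj.
by rewrite /dehomogenize scalerA mulfV // scale1r.
Qed.

Lemma proj_repr_class (l : 'rV[C]_a.+1) (nz_l : nonzero l) :
  exists2 c, c != 0 &
    proj_repr (@quo_class C (affine_space C a.+1) nonzero scal _ nz_l) = c *: l.
Proof.
apply: scal_sym.
exact: (@quo_elt_class C (affine_space C a.+1) nonzero scal scal_refl _ nz_l).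
Qed.

Lemma chart_point u : chart (proj_point u).
Proof.
rewrite /chart /= /proj_point; have [c nzc ->] := proj_repr_class (@homogenize_neq0 u).
by rewrite mxE homogenize0 mulr1.
Qed.

Lemma proj_point_coord u : proj_coord (proj_point u) = u.
Proof.
rewrite /proj_coord /proj_point.
have [c nzc ->] := proj_repr_class (@homogenize_neq0 u).
by rewrite dehomogenize_scale // homogenizeK.
Qed.

Lemma proj_coord_point L : chart L -> proj_point (proj_coord L) = L.
Proof.
move=> nzL; rewrite -[RHS]quo_eltK.
apply: (@quo_class_eq _ (affine_space C a.+1) _ scal scal_sym scal_trans).
by exists (proj_repr L 0 0); last exact: dehomogenizeK.
Qed.

Lemma quo_preimage_proj (W : set (point (projective_space C a))) u :
  quo_preimage W (homogenize u) <-> W (proj_point u).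
Proof.
exact: (@quo_preimageE _ (affine_space C a.+1) _ scal scal_refl scal_sym scal_trans).
Qed.

Lemma quo_preimage_chart :
  quo_preimage chart = [set l : 'rV[C]_a.+1 | l 0 0 != 0].
Proof.
apply/seteqP; split=> [l [L nzL /quo_mem[_ [c nzc ->]]]|l /= nzl].
  by rewrite /= mxE mulf_neq0.
have nz_l : nonzero l by move=> l0; move: nzl; rewrite l0 mxE eqxx.
apply/(@quo_preimageE _ (affine_space C a.+1) _ scal scal_refl scal_sym scal_trans
  chart _ nz_l).
rewrite /chart /=; have [c nzc ->] := proj_repr_class nz_l.
by rewrite mxE mulf_neq0.
Qed.

Lemma chart_open : zopen chart.
Proof.
rewrite /zopen /= quo_preimage_chart; apply: affine_open_nz.
exact: polyfun_coord.
Qed.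

Lemma chart_regular (g : 'rV[C]_a -> C) :
  polyfun g -> regular chart (fun L => g (proj_coord L)).
Proof.
move=> Pg; exists (fun l : 'rV[C]_a.+1 => g (dehomogenize l)).
  rewrite quo_preimage_chart; apply: polyfun_comp_regular Pg.
    exact/affine_open_nz/polyfun_coord.
  move=> j; apply: (@affine_regular_ext _ _ _ (fun l : 'rV[C]_a.+1 =>
    (l 0 0)^-1 * l 0 (rshift 1 j))).
    by move=> l _; rewrite !mxE.
  have := affine_regular_inv (affine_regular_polyfun affine_openT
    (@polyfun_coord C a.+1 0)).
  rewrite setTI => reg0; apply: affine_regular_mul reg0 _.
  apply: affine_regular_polyfun; first exact/affine_open_nz/polyfun_coord.
  exact: polyfun_coord.
move=> L nzL l /quo_mem[_ [c nzc ->]].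
by rewrite dehomogenize_scale.
Qed.

Lemma polymap_homogenize : polymap homogenize.
Proof.
have Pcst : polymap (fun=> 1%:M : 'M[C]_1) by move=> n j; apply: polyfun_cst.
exact: polymap_row_mx (Pcst a) (@polymap_id C a).
Qed.

Lemma regular_proj_point (W : set (point (projective_space C a))) g :
  zopen W -> regular W g ->
  affine_regular [set u | W (proj_point u)] (fun u => g (proj_point u)).
Proof.
move=> oW [F regF Fg].
have eqW : [set u | W (proj_point u)] =
    setT `&` [set u | quo_preimage W (homogenize u)].
  by rewrite setTI; apply/seteqP; split=> u /quo_preimage_proj.
rewrite eqW.
apply: affine_regular_ext (regular_comp affine_openT
   (regular_map_polymap affine_openT polymap_homogenize) regF) => u [_] /=.
move=> /quo_preimage_proj Wu; apply: Fg Wu _ _.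
apply/quo_mem; split; first exact: homogenize_neq0.
exact: (@quo_elt_class C (affine_space C a.+1) nonzero scal).
Qed.

Lemma open_proj_point (W : set (point (projective_space C a))) :
  zopen W -> affine_open [set u | W (proj_point u)].
Proof.
move=> oW; have -> : [set u | W (proj_point u)] =
    setT `&` [set u | quo_preimage W (homogenize u)].
  by rewrite setTI; apply/seteqP; split=> u /quo_preimage_proj.
apply: regular_map_open affine_openT _ oW.
exact: regular_map_polymap affine_openT polymap_homogenize.
Qed.

End ProjectiveChart.

Section ProductWithProjectiveSpace.
Variables (C : numFieldType) (gT : finGroupType) (G : {group gT}).
Variables (n : nat) (rV : mx_representation C G n) (a : nat).

Let X := linear_quotient rV.
Let Y := projective_space C a.
Let rZ := dsum_repr rV (triv_repr G a).
Let Z := linear_quotient rZ.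

Definition join_point (z : point X * point Y) : 'rV[C]_(n + a) :=
  row_mx (orb_repr z.1) (proj_coord z.2).

Definition split_point (w : 'rV[C]_(n + a)) : point X * point Y :=
  (orb rV (lsubmx w), proj_point (rsubmx w)).

Lemma split_pointM w g : g \in G -> split_point (w *m rZ g) = split_point w.
Proof.
by move=> Gg; rewrite /split_point lsubmx_dsum rsubmx_dsum /= mulmx1 orb_mul.
Qed.

Lemma split_join z : chart z.2 -> split_point (join_point z) = z.
Proof.
case: z => O L /= nzL; rewrite /split_point /join_point row_mxKl row_mxKr.
by rewrite orb_reprK proj_coord_point.
Qed.

Lemma join_split w : orb rZ (join_point (split_point w)) = orb rZ w.
Proof.
rewrite /join_point /= proj_point_coord; have [g Gg ->] := orb_reprP rV (lsubmx w).
rewrite -[in RHS](orb_mul rZ w Gg) dsum_reprE /= mulmx1.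
by [].
Qed.

(** The variables of [p] are separated as a sum of products.  The factors on [V]
need not be invariant, but as the group acts on [V] only, they may be averaged
without changing [p]. *)
Lemma tensor_invariant (p : 'rV[C]_(n + a) -> C) :
  polyfun p -> invariant_on rZ setT p ->
  @tensor C X Y setT (@chart C a) (fun z => p (join_point z)).
Proof.
move=> Pp invp; have [J [f [g [Pf Pg pE]]]] := polyfun_split Pp.
pose N : C := (#|G|%:R)^-1.
exists #|J|, (fun i O => N * orbit_sum rV (f (enum_val i)) (orb_repr O)),
  (fun i L => g (enum_val i) (proj_coord L)); split.
- move=> i; apply/linear_quotient_regular.
  apply: (@affine_regular_ext _ _ _ (fun v => N * orbit_sum rV (f (enum_val i)) v)).
    move=> v _; have [h Gh ->] := orb_reprP rV v.
    by rewrite orbit_sum_inv.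
  apply: affine_regular_polyfun; first exact: affine_openT.
  exact: polyfun_mul (polyfun_cst _ _) (polyfun_orbit_sum _ (Pf _)).
- by move=> i; apply: chart_regular.
have nzG : (#|G|%:R : C) != 0 by rewrite pnatr_eq0 -lt0n cardG_gt0.
move=> z; apply: (mulfI nzG).
have -> : #|G|%:R * p (join_point z) = \sum_(h in G) p (join_point z *m rZ h).
  rewrite mulr_natl -sumr_const; apply: eq_bigr => h Gh.
  by rewrite invp.
rewrite -(big_enum_val (fun j =>
  N * orbit_sum rV (f j) (orb_repr z.1) * g j (proj_coord z.2))) /=.
rewrite mulr_sumr; under eq_bigr do rewrite pE.
rewrite exchange_big /=; apply: eq_bigr => j _.
rewrite !mulrA mulfV // mul1r mulr_suml; apply: eq_bigr => h _.
by rewrite lsubmx_dsum rsubmx_dsum /= mulmx1 row_mxKl row_mxKr.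
Qed.

Definition split_set (U0 : set (point X)) (V0 : set (point Y)) : set 'rV[C]_(n + a) :=
  [set w | U0 (orb rV (lsubmx w)) /\ V0 (proj_point (rsubmx w))].

Lemma split_set_open U0 V0 : zopen U0 -> zopen V0 -> affine_open (split_set U0 V0).
Proof.
move=> /linear_quotient_open oU0 /open_proj_point oV0.
have oU := regular_map_open affine_openT
  (regular_map_polymap affine_openT (@polymap_lsubmx C n a)) oU0.
have oV := regular_map_open affine_openT
  (regular_map_polymap affine_openT (@polymap_rsubmx C n a)) oV0.
by have := affine_openI oU oV; rewrite !setTI.
Qed.

Lemma tensor_pullback U0 V0 h : zopen U0 -> zopen V0 -> @tensor C X Y U0 V0 h ->
  affine_regular (split_set U0 V0) (fun w => h (split_point w)).
Proof.
move=> oU0 oV0 [m [f [g [regf regg hE]]]].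
have oS := split_set_open oU0 oV0.
apply: (@affine_regular_ext _ _ _ (fun w => \sum_(k < m)
    f k (orb rV (lsubmx w)) * g k (proj_point (rsubmx w)))) => [w _|].
  by rewrite hE.
apply: affine_regular_sum => // k; apply: affine_regular_mul.
  have /linear_quotient_regular regfk := regf k.
  apply: affine_regular_sub oS _ (regular_comp affine_openT
    (regular_map_polymap affine_openT (@polymap_lsubmx C n a)) regfk).
  by move=> w [].
apply: affine_regular_sub oS _ (regular_comp affine_openT
  (regular_map_polymap affine_openT (@polymap_rsubmx C n a))
  (regular_proj_point oV0 (regg k))).
by move=> w [].
Qed.

Lemma prod_projective_birational : birational (prod_space X Y) Z.
Proof.
pose U : set (point X * point Y) := [set z | chart z.2].
pose phi z : point Z := orb rZ (join_point z).
pose psi (O : point Z) := split_point (orb_repr O).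
have psiE w : psi (orb rZ w) = split_point w.
  by rewrite /psi; have [g Gg ->] := orb_reprP rZ w; rewrite split_pointM.
have oX : @zopen C X setT by apply/linear_quotient_open/affine_openT.
have oU : @zopen C (prod_space X Y) U.
  move=> z Uz; exists setT, (@chart C a), (fun=> 1); split=> //.
  - exact: chart_open.
  - have := @tensor_invariant (fun=> 1) (@polyfun_cst C _ 1); exact.
  split; last by move=> w [].
  by split=> //; apply: oner_neq0.
have chart_nonvanishing q W : (forall w, q w != 0 -> W (orb rZ w)) ->
  nonvanishing setT (@chart C a) (fun z => q (join_point z)) `<=` U `&` phi @^-1` W.
  by move=> qW z [_ Uz qz]; split=> //; apply: qW.
exists U, setT, phi, psi; split.
- split=> //; exists (orb rV 0, proj_point 0); exact: chart_point.
- split; first exact/linear_quotient_open/affine_openT.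
  by exists (orb rZ 0).
- split=> [//|W oW _].
  have /linear_quotient_open oA := oW.
  split=> [z [Uz Wz]|f /linear_quotient_regular regf z [Uz Wz]].
    have [q [Pq invq qz qW]] := invariant_open (stable_preimage (W := W)) oA Wz.
    exists setT, (@chart C a), (fun z => q (join_point z)); split=> //.
    + exact: chart_open.
    + exact: tensor_invariant.
    by split; [split | apply: chart_nonvanishing].
  have invf : invariant_on rZ [set w | W (orb rZ w)] (fun w => f (orb rZ w)).
    by move=> w g Gg _; rewrite orb_mul.
  have [p [q [[Pp Pq] [invp invq] qz qW fq]]] :=
    invariant_fraction (stable_preimage (W := W)) invf regf Wz.
  exists setT, (@chart C a), (fun z => p (join_point z)), (fun z => q (join_point z)).
  split=> //; [exact: chart_open | exact: tensor_invariant | exact: tensor_invariant |].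
  split; [by split | exact: chart_nonvanishing |].
  move=> w [_ _ qw]; have Ww := qW _ qw.
  by rewrite -fq // mulfK.
- split=> [O _|W oW WU]; first by rewrite /psi /U /=; apply: chart_point.
  have preE : [set w | (setT `&` psi @^-1` W) (orb rZ w)] = [set w | W (split_point w)].
    by apply/seteqP; split=> w /=; rewrite /preimage /= psiE => // -[].
  split.
    apply/linear_quotient_open; rewrite preE; apply/affine_openP => w Ww.
    have [U0 [V0 [k [oU0 oV0 tk [[Uw Vw kw] kW]]]]] := oW _ Ww.
    have /affine_openP/(_ w)[//|p [Pp pw pD]] :=
      affine_regular_nz (tensor_pullback oU0 oV0 tk).
    by exists p; split=> // u /pD[[Uu Vu] ku]; apply: kW.
  move=> f regf; apply/linear_quotient_regular; rewrite preE.
  apply: (@affine_regular_ext _ _ _ (fun w => f (split_point w))) => [w _|].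
    by rewrite /= psiE.
  apply: affine_regular_local => w Ww.
  have [U0 [V0 [h [k [oU0 oV0 th tk [[Uw Vw kw] kW fE]]]]]] := regf _ Ww.
  have regk := tensor_pullback oU0 oV0 tk.
  exists (split_set U0 V0 `&` [set w | k (split_point w) != 0]); split=> //.
    apply: (@affine_regular_ext _ _ _
      (fun w => h (split_point w) * (k (split_point w))^-1)).
      by move=> u [[Uu Vu] ku]; rewrite fE.
    apply: affine_regular_mul (affine_regular_inv regk).
    exact: affine_regular_sub (affine_regular_nz regk) (@subIsetl _ _ _)
      (tensor_pullback oU0 oV0 th).
  by move=> u [[Uu Vu] ku]; apply: kW.
split=> [z Uz|O _]; first by rewrite /phi psiE split_join.
by rewrite -(orb_reprK O) psiE /phi join_split.
Qed.

End ProductWithProjectiveSpace.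

Lemma stably_equiv_birational (C : numClosedFieldType) (gT : finGroupType)
    (G : {group gT}) n m (rV : mx_representation C G n)
    (rW : mx_representation C G m) :
  stably_equiv rV rW -> stably_birational (linear_quotient rV) (linear_quotient rW).
Proof.
case=> i [j eqVW]; exists (i + 0)%N, (j + 0)%N.
apply: birational_trans (linear_quotient_irreducible _) _ _.
  exact: prod_projective_birational.
apply: birational_trans (linear_quotient_irreducible _) (eqVW 0%N) _.
exact/birational_sym/prod_projective_birational.
Qed.

(** * Quotients by isoclinic groups *)

Section PullbackRepresentation.
Variables (C : fieldType) (gT hT : finGroupType).
Variables (K : {group hT}) (G : {group gT}) (p : {morphism K >-> gT}).
Hypothesis pK : p @* K = G.
Variables (n : nat) (rG : mx_representation C G n).

Lemma pullback_mx_repr : mx_repr K (fun x => rG (p x)).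
Proof.
have Gp x : x \in K -> p x \in G by move=> Kx; rewrite -pK mem_morphim.
split=> [|x y Kx Ky]; first by rewrite morph1 repr_mx1.
by rewrite morphM // repr_mxM ?Gp.
Qed.

Definition pullback_repr := MxRepresentation pullback_mx_repr.

Lemma pullback_linear_quotient : linear_quotient rG = linear_quotient pullback_repr.
Proof.
apply: linear_quotient_eq => v w; split=> [[g Gg ->]|[x Kx ->]].
  have /morphimP[x _ Kx ->] : g \in p @* K by rewrite pK.
  by exists x.
have Gpx : p x \in G by rewrite -pK mem_morphim.
by exists (p x).
Qed.

End PullbackRepresentation.

Section StableBirationality.
Variables (C : numClosedFieldType) (gT1 gT2 : finGroupType).
Variables (G1 : {group gT1}) (G2 : {group gT2}).

Lemma generically_free_at n (rG : mx_representation C G1 n) :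
  generically_free rG -> exists v : 'rV[C]_n, free_at rG v.
Proof. by case=> U [_ [v Uv] freeU]; exists v => g Gg; apply: freeU. Qed.

(** An element that fixes the base point lies in the kernel of [p]; if all linear
characters are trivial on it, it also lies in the derived group. *)
Lemma pullback_stably_free (hT : finGroupType) (K : {group hT})
    (p : {morphism K >-> gT1}) (pK : p @* K = G1) n
    (rG : mx_representation C G1 n) v :
  free_at rG v ->
  (forall x, x \in [~: K, K] -> p x = 1%g -> x = 1%g) ->
  exists m (rW : mx_representation C K m) w,
    stably_equiv (pullback_repr pK rG) rW /\ free_at rW w.
Proof.
move=> freeG kerp; have [cs [lin_cs der_cs]] := enough_characters C K.
have p1 x : x \in K -> v *m rG (p x) = v -> p x = 1%g.
  by move=> Kx; apply: freeG; rewrite -pK mem_morphim.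
have effV : effective_at (pullback_repr pK rG) v.
  by move=> x Kx /(p1 x Kx) /= ->; rewrite repr_mx1.
have [m [rW [w [eqW effW kerW]]]] := adjoin_characters effV lin_cs.
exists m, rW, w; split=> // x Kx fix_w.
have [rx csx] := kerW x Kx (effW x Kx fix_w).
apply: kerp; first by rewrite -derg1; apply: der_cs.
by apply: p1 => //; rewrite [rG _]rx mulmx1.
Qed.

End StableBirationality.

Lemma isoclinic_stably_birational (C : numClosedFieldType)
    (gT1 gT2 : finGroupType) (G1 : {group gT1}) (G2 : {group gT2})
    (n1 n2 : nat) (rG1 : mx_representation C G1 n1)
    (rG2 : mx_representation C G2 n2) :
  isoclinic G1 G2 -> generically_free rG1 -> generically_free rG2 ->
  stably_birational (linear_quotient rG1) (linear_quotient rG2).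
Proof.
case=> phi /generically_free_at[v1 free1] /generically_free_at[v2 free2].
have [K isoK _] := isoclinism_graph phi.
have [fstK sndK] := isoclinic_graph_proj isoK; have [_ _ _ KK] := isoK.
pose p1 := restrm_morphism (finset.subsetT K) (fst_morphism gT1 gT2).
pose p2 := restrm_morphism (finset.subsetT K) (snd_morphism gT1 gT2).
have p1K : p1 @* K = G1 by rewrite morphim_restrm finset.setIid.
have p2K : p2 @* K = G2 by rewrite morphim_restrm finset.setIid.
have [|m1 [rW1 [w1 [eqW1 freeW1]]]] := pullback_stably_free p1K free1.
  move=> [a b] KKx /= a1; have := KK _ KKx.
  by rewrite /= [a]a1 eqxx => /esym/eqP->.
have [|m2 [rW2 [w2 [eqW2 freeW2]]]] := pullback_stably_free p2K free2.
  move=> [a b] KKx /= b1; have := KK _ KKx.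
  by rewrite /= [b]b1 eqxx => /eqP->.
rewrite (pullback_linear_quotient p1K rG1) (pullback_linear_quotient p2K rG2).
apply: stably_equiv_birational; apply: stably_equiv_trans eqW1 _.
apply: stably_equiv_trans (stably_equiv_free freeW1 freeW2) _.
exact: stably_equiv_sym.
Qed.

Theorem theorem3p2 (R : realType) :
  (forall (aT1 gT1 aT2 gT2 qT : finGroupType)
      (A1 : {group aT1}) (G1 : {group gT1})
      (A2 : {group aT2}) (G2 : {group gT2}) (G : {group qT})
      (e1 : central_extension A1 G1 G) (e2 : central_extension A2 G2 G),
    toroidally_related R e1 e2 -> isoclinic G1 G2) /\
  (forall (gT1 gT2 : finGroupType) (G1 : {group gT1}) (G2 : {group gT2})
      (phi : isoclinism G1 G2),
    toroidally_related R (center_extension G1)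
      (transport_extension (center_extension G2)
         (isom_sym (iso_quo_isom phi)))) /\
  (forall (gT1 gT2 : finGroupType) (G1 : {group gT1}) (G2 : {group gT2}),
    isoclinic G1 G2 ->
    forall (n1 n2 : nat) (rG1 : mx_representation R[i] G1 n1)
      (rG2 : mx_representation R[i] G2 n2),
    generically_free rG1 -> generically_free rG2 ->
    stably_birational (linear_quotient rG1) (linear_quotient rG2)).
Proof.
split; first by move=> *; apply: toroidally_related_isoclinic; eassumption.
split=> [gT1 gT2 G1 G2 phi|gT1 gT2 G1 G2 iso12 n1 n2 rG1 rG2].
  exact: isoclinism_toroidally_related.
exact: isoclinic_stably_birational.
Qed.
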